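(* Let $d \geq 2$ be an integer and let $T>0$. For every $k \in \mathbb{N}$ and every $\alpha \in (0,1)$ there exists a velocity field $u \in C^k([0,T], C^\alpha(\mathbb{T}^d,\mathbb{R}^d))$, satisfying $\operatorname{div} u(t,\cdot) = 0$ in the sense of distributions on $\mathbb{T}^d$ for every $t \in [0,T]$, such that there does not exist any measure-preserving selection of characteristics for $u$.
   Context: $\mathbb{T}^d := (\mathbb{R}/\mathbb{Z})^d$ is the $d$-dimensional torus and $\mathscr{L}^d$ is the Lebesgue measure on it. $C^\alpha(\mathbb{T}^d,\mathbb{R}^d)$ is the Banach space of $\alpha$-Hölder continuous maps, and $C^k([0,T],E)$ denotes the $k$ times continuously differentiable maps from $[0,T]$ to the Banach space $E$. Definition. Given a measurable $u : [0,T]\times\mathbb{T}^d \to \mathbb{R}^d$ with $\operatorname{div} u(t,\cdot)=0$, a map $X : [0,T]\times \mathbb{T}^d \to \mathbb{T}^d$ is a measure-preserving selection of characteristics (for $u$) if: (i) for every $t \in [0,T]$, the map $X_t := X(t,\cdot) : \mathbb{T}^d \to \mathbb{T}^d$ is Lebesgue measurable and $(X_t)_\sharp \mathscr{L}^d = \mathscr{L}^d$ (pushforward measure); (ii) for almost every $x \in \mathbb{T}^d$ the map $t \mapsto u(t,X(t,x))$ is in $L^1([0,T])$ and $X(t,x) = x + \int_0^t u(s,X(s,x))\,ds$ (in $\mathbb{T}^d$, i.e. modulo $\mathbb{Z}^d$) for every $t \in [0,T]$. *)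

(* Defs.v *)
From HB Require Import structures.
From mathcomp Require Import all_boot all_order all_algebra.
From mathcomp Require Import generic_quotient ring_quotient.
From mathcomp Require Import all_classical all_reals all_analysis.

Set Implicit Arguments.
Unset Strict Implicit.
Unset Printing Implicit Defensive.

Import Order.TTheory GRing.Theory Num.Theory.
Import numFieldNormedType.Exports.

Local Open Scope classical_set_scope.
Local Open Scope ring_scope.

(* R / Z, as a quotient group. *)
Definition circle (R : realType) : Type :=
  Quotient.quot (GRing.ZmodClosed.clone R (@Num.int_num_subdef R) _).
HB.instance Definition _ (R : realType) := GRing.Zmodule.on (circle R).
HB.instance Definition _ (R : realType) := EqQuotient.on (circle R).
HB.instance Definition _ (R : realType) := isPointed.Build (circle R) 0.

Definition circle_pi (R : realType) (x : R) : circle R := \pi_(circle R)%qT x.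

Section circle_measurable.
Variable R : realType.

(* The Borel sigma-algebra of R / Z: the sets with a Borel preimage in R. *)
Definition circle_borel : set (set (circle R)) :=
  [set A | measurable (@circle_pi R @^-1` A : set (measurableTypeR R))].

Let circle_borel0 : circle_borel set0.
Proof. by rewrite /circle_borel /= preimage_set0. Qed.

Let circle_borelC A : circle_borel A -> circle_borel (~` A).
Proof.
by rewrite /circle_borel /= preimage_setC => mA; exact: measurableC.
Qed.

Let circle_borel_bigcup (F : (set (circle R))^nat) :
  (forall i, circle_borel (F i)) -> circle_borel (\bigcup_i F i).
Proof.
rewrite /circle_borel /= preimage_bigcup => mF.
by apply: bigcupT_measurable => i; exact: mF.
Qed.

HB.instance Definition _ := @isMeasurable.Build default_measure_display
  (circle R) circle_borel circle_borel0 circle_borelC circle_borel_bigcup.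

Lemma measurable_circle_pi :
  measurable_fun [set: measurableTypeR R] (@circle_pi R).
Proof. by move=> _ A mA; rewrite setTI. Qed.

End circle_measurable.

Section circle_measure.
Variable R : realType.

Let D : set (measurableTypeR R) := `[0, 1[%classic.

Let measurable_D : measurable D. Proof. exact: measurable_itv. Qed.

(* Lebesgue measure of R / Z, computed on the fundamental domain [0, 1[. *)
Definition circle_measure : set (circle R) -> \bar R :=
  pushforward (mrestr (@lebesgue_measure R) measurable_D) (@circle_pi R).

Let circle_measure0 : circle_measure set0 = 0%E.
Proof. by rewrite /circle_measure /pushforward preimage_set0 measure0. Qed.

Let circle_measure_ge0 A : (0 <= circle_measure A)%E.
Proof. by rewrite /circle_measure /pushforward; apply: measure_ge0. Qed.

Let circle_measure_sigma_additive : semi_sigma_additive circle_measure.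
Proof.
move=> F mF tF mUF; rewrite /circle_measure /pushforward preimage_bigcup.
apply: measure_semi_sigma_additive.
- by move=> n; exact: mF.
- apply/trivIsetP => /= i j _ _ ij; rewrite -preimage_setI.
  by move/trivIsetP : tF => /(_ _ _ _ _ ij) ->//; rewrite preimage_set0.
- by rewrite -preimage_bigcup; exact: mUF.
Qed.

HB.instance Definition _ := isMeasure.Build _ _ _ circle_measure
  circle_measure0 circle_measure_ge0 circle_measure_sigma_additive.

Let circle_measure_setT : circle_measure setT = 1%E.
Proof.
rewrite /circle_measure /pushforward preimage_setT /mrestr setTI.
by rewrite lebesgue_measure_itv/= lte_fin ltr01 oppr0 adde0.
Qed.

HB.instance Definition _ :=
  Measure_isProbability.Build _ _ _ circle_measure circle_measure_setT.

End circle_measure.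

(* T^d = (R / Z)^d, with the product sigma-algebra. *)
Notation torus R d := (d.-tuple (circle R)).

Definition torus_cons (R : realType) (d : nat)
  (x : circle R * torus R d) : torus R d.+1 := [tuple of x.1 :: x.2].

Lemma measurable_torus_cons (R : realType) (d : nat) :
  measurable_fun setT (@torus_cons R d).
Proof. exact: (measurable_cons measurable_fst measurable_snd). Qed.

HB.instance Definition _ (R : realType) (d : nat) :=
  @isMeasurableFun.Build _ _ _ _ (@torus_cons R d)
    (@measurable_torus_cons R d).

(* The d-fold product of [circle_measure], on Borel sets. *)
Fixpoint torus_measure (R : realType) (d : nat) : probability (torus R d) R :=
  match d with
  | 0 => dirac ([tuple] : torus R 0)
  | d'.+1 => distribution (@circle_measure R \x torus_measure R d')%E
               (@torus_cons R d')
  end.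

(* The completion of [torus_measure], i.e. Lebesgue measure on the
   sigma-algebra of Lebesgue measurable sets. *)
Definition lebesgue_torus (R : realType) (d : nat) :
    set (caratheodory_type (torus_measure R d)^*%mu) -> \bar R :=
  @completed_measure_extension _ _ R (torus_measure R d).

Definition torus_proj (R : realType) (d : nat) (v : 'rV[R]_d) : torus R d :=
  [tuple circle_pi (v ord0 i) | i < d].

Definition torus_lift (R : realType) (d : nat) (x : torus R d) : 'rV[R]_d :=
  \row_i repr (tnth x i).

Definition torus_shift (R : realType) (d : nat) (x : torus R d)
    (v : 'rV[R]_d) : torus R d :=
  [tuple tnth x i + circle_pi (v ord0 i) | i < d].

Lemma torus_liftK (R : realType) (d : nat) :
  cancel (@torus_lift R d) (@torus_proj R d).
Proof.
by move=> x; apply: eq_from_tnth => i; rewrite tnth_mktuple mxE /circle_pi reprK.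
Qed.

Section holder_space.
Variables (R : realType) (d : nat) (a : R).
Implicit Types f g : torus R d -> 'rV[R]_d.

Definition holder_values f (x : torus R d) : R := `|f x|.

(* The distance on the torus is the infimum of |x - y| over all lifts, so the
   Hoelder quotients of f may be taken over R^d; for x = y the quotient is 0,
   because division by 0 gives 0. *)
Definition holder_quotients f (p : 'rV[R]_d * 'rV[R]_d) : R :=
  `|f (torus_proj p.1) - f (torus_proj p.2)| / `|p.1 - p.2| `^ a.

Definition is_holder : {pred torus R d -> 'rV[R]_d} := fun f =>
  `[< has_ubound (range (holder_values f)) /\
      has_ubound (range (holder_quotients f)) >].

Record holder_map := HolderMap {
  holder_fun :> torus R d -> 'rV[R]_d ;
  holder_funP : holder_fun \in is_holder }.

HB.instance Definition _ := [isSub for holder_fun].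
HB.instance Definition _ := [Choice of holder_map by <:].

Let quotients_ge0 f p : 0 <= holder_quotients f p.
Proof. by rewrite divr_ge0 ?powR_ge0. Qed.

Let valuesD f g x :
  holder_values (f + g) x <= holder_values f x + holder_values g x.
Proof. exact: ler_normD. Qed.

Let quotientsD f g p :
  holder_quotients (f + g) p <= holder_quotients f p + holder_quotients g p.
Proof.
rewrite /holder_quotients -mulrDl ler_wpM2r ?invr_ge0 ?powR_ge0//=.
by rewrite opprD addrACA ler_normD.
Qed.

Let valuesZ (c : R) f x : holder_values (c *: f) x = `|c| * holder_values f x.
Proof. exact: normrZ. Qed.

Let quotientsZ (c : R) f p :
  holder_quotients (c *: f) p = `|c| * holder_quotients f p.
Proof. by rewrite /holder_quotients /= -scalerBr normrZ mulrA. Qed.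

Let ubound_add (I : Type) (h h1 h2 : I -> R) :
  (forall i, h i <= h1 i + h2 i) -> has_ubound (range h1) ->
  has_ubound (range h2) -> has_ubound (range h).
Proof.
move=> hh [M1 M1P] [M2 M2P]; exists (M1 + M2) => _ [i _ <-].
by rewrite (le_trans (hh i))// lerD// ?M1P ?M2P//; exists i.
Qed.

Let ubound_scale (I : Type) (c : R) (h h1 : I -> R) :
  (forall i, h i = `|c| * h1 i) -> has_ubound (range h1) ->
  has_ubound (range h).
Proof.
move=> hh [M1 M1P]; exists (`|c| * M1) => _ [i _ <-].
by rewrite hh ler_wpM2l// M1P//; exists i.
Qed.

Let sup_add (I : Type) (i0 : I) (h h1 h2 : I -> R) :
  (forall i, h i <= h1 i + h2 i) -> has_ubound (range h1) ->
  has_ubound (range h2) ->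
  sup (range h) <= sup (range h1) + sup (range h2).
Proof.
move=> hh u1 u2; apply: ge_sup; first by exists (h i0), i0.
move=> _ [i _ <-]; rewrite (le_trans (hh i))// lerD//.
  by apply: ub_le_sup => //; exists i.
by apply: ub_le_sup => //; exists i.
Qed.

Let sup_scale (I : Type) (i0 : I) (c : R) (h h1 : I -> R) :
  (forall i, h i = `|c| * h1 i) -> has_ubound (range h1) ->
  sup (range h) = `|c| * sup (range h1).
Proof.
move=> hh u1; have [c0|c0] := eqVneq c 0.
  rewrite c0 normr0 mul0r (_ : range h = [set 0]) ?sup1//.
  apply/seteqP; split=> [_ [i _ <-]|_ ->]; first by rewrite hh c0 normr0 mul0r.
  by exists i0 => //; rewrite hh c0 normr0 mul0r.
have c_gt0 : 0 < `|c| by rewrite normr_gt0.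
apply/eqP; rewrite eq_le; apply/andP; split.
  apply: ge_sup; first by exists (h i0), i0.
  move=> _ [i _ <-]; rewrite hh ler_wpM2l//.
  by apply: ub_le_sup => //; exists i.
rewrite -ler_pdivlMl//; apply: ge_sup; first by exists (h1 i0), i0.
move=> _ [i _ <-]; rewrite ler_pdivlMl// -hh.
by apply: ub_le_sup; [exact: ubound_scale hh u1|exists i].
Qed.

Let is_holder_submod_closed : submod_closed is_holder.
Proof.
split=> [|c f g /asboolP[f1 f2] /asboolP[g1 g2]]; apply/asboolP.
  split; exists 0 => _ [x _ <-]; first by rewrite /holder_values normr0.
  by rewrite /holder_quotients /= subrr normr0 mul0r.
split.
  apply: (ubound_add (valuesD _ _)) => //.
  exact: ubound_scale (valuesZ c f) f1.
apply: (ubound_add (quotientsD _ _)) => //.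
exact: ubound_scale (quotientsZ c f) f2.
Qed.

HB.instance Definition _ :=
  GRing.isSubmodClosed.Build R _ is_holder is_holder_submod_closed.
HB.instance Definition _ := [SubChoice_isSubLmodule of holder_map by <:].

(* The norm of C^a(T^d, R^d); |.| on R^d is the (equivalent) maximum norm. *)
Definition holder_norm (f : holder_map) : R :=
  sup (range (holder_values f)) + sup (range (holder_quotients f)).

Let valuesP (f : holder_map) : has_ubound (range (holder_values f)).
Proof. by have /asboolP[] := holder_funP f. Qed.

Let quotientsP (f : holder_map) : has_ubound (range (holder_quotients f)).
Proof. by have /asboolP[] := holder_funP f. Qed.

Let x0 : torus R d := torus_proj 0.
Let p0 : 'rV[R]_d * 'rV[R]_d := (0, 0).

Let holder_normD (f g : holder_map) :
  holder_norm (f + g) <= holder_norm f + holder_norm g.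
Proof.
rewrite /holder_norm addrACA lerD//.
  exact: (sup_add x0 (valuesD f g)).
exact: (sup_add p0 (quotientsD f g)).
Qed.

Let holder_normZ (c : R) (f : holder_map) :
  holder_norm (c *: f) = `|c| * holder_norm f.
Proof.
rewrite /holder_norm mulrDr; congr (_ + _).
  exact: (sup_scale x0 (valuesZ c f)).
exact: (sup_scale p0 (quotientsZ c f)).
Qed.

Let holder_norm0_eq0 (f : holder_map) : holder_norm f = 0 -> f = 0.
Proof.
move=> f0; apply/val_inj/funext => x /=; apply/normr0_eq0/eqP.
rewrite eq_le normr_ge0 andbT -f0 -[leLHS]addr0 lerD//.
  by apply: ub_le_sup => //; exists x.
apply: le_trans (quotients_ge0 f p0) _.
by apply: ub_le_sup => //; exists p0.
Qed.

HB.instance Definition _ := @Lmodule_isNormed.Build R holder_map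
  holder_norm holder_normD holder_normZ holder_norm0_eq0.

End holder_space.

(* u is in C^k([a, b], E); at a and b the derivatives are one-sided. *)
Definition Ck_on (R : realType) (E : normedModType R) (a b : R) (k : nat)
    (u : R -> E) : Prop :=
  exists D : nat -> R -> E,
    [/\ {in `[a, b], D 0 =1 u},
        forall j t, (j < k)%N -> t \in `[a, b] ->
          (s - t)^-1 *: (D j s - D j t) @[s --> within `[a, b]%classic t^']
            --> D j.+1 t
      & forall j, (j <= k)%N -> {within `[a, b]%classic, continuous (D j)}].

Definition basis_vec (R : realType) (d : nat) (i : 'I_d) : 'rV[R]_d :=
  delta_mx ord0 i.

(* The iterated partial derivative of f along the coordinates listed in s. *)
Definition partial (R : realType) (d : nat) (s : seq 'I_d)
    (f : 'rV[R]_d -> R) : 'rV[R]_d -> R :=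
  foldr (fun i g x => 'D_(basis_vec R i) g x) f s.

Definition smooth (R : realType) (d : nat) (f : 'rV[R]_d -> R) : Prop :=
  forall s : seq 'I_d, continuous (partial s f) /\
    forall i x, derivable (partial s f) x (basis_vec R i).

Definition torus_smooth (R : realType) (d : nat) (phi : torus R d -> R) :=
  smooth (phi \o @torus_proj R d).

Definition torus_partial (R : realType) (d : nat) (i : 'I_d)
    (phi : torus R d -> R) (x : torus R d) : R :=
  'D_(basis_vec R i) (phi \o @torus_proj R d) (torus_lift x).

Definition div_free (R : realType) (d : nat) (v : torus R d -> 'rV[R]_d) :=
  forall phi : torus R d -> R, torus_smooth phi ->
    \int[torus_measure R d]_x (\sum_(i < d) v x ord0 i * torus_partial i phi x)
      = 0.

Record measure_preserving_selection (R : realType) (d : nat) (T : R)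
    (u : R -> torus R d -> 'rV[R]_d) (X : R -> torus R d -> torus R d) :
    Prop := {
  selection_measurable : forall t, t \in `[0, T] ->
    measurable_fun [set: caratheodory_type (torus_measure R d)^*%mu] (X t) ;
  selection_pushforward : forall t, t \in `[0, T] ->
    forall A : set (torus R d), measurable A ->
      pushforward (@lebesgue_torus R d) (X t) A = torus_measure R d A ;
  selection_characteristic : {ae torus_measure R d, forall x,
    (forall i, (@completed_lebesgue_measure R).-integrable `[0, T]
       (fun s => (u s (X s x) ord0 i)%:E)) /\
    forall t, t \in `[0, T] -> X t x = torus_shift x
      (\row_i \int[@completed_lebesgue_measure R]_(s in `[0, t])
         u s (X s x) ord0 i)} }.

(* Main.v *)
(* On the time slot ]T/2^(n+1), T/2^n] the field is a shear in one of the first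
   two coordinates, the direction alternating with n; the amplitude decays like
   q^(-n) and the oscillation scale is q^(-n-2), so for q large all norms involved
   decay geometrically and u is C^k in time up to the singular time t = 0.  For
   t > 0 the characteristics are explicit; followed backwards from t = T they
   converge uniformly to a map pi, and any selection satisfies pi (X_T x) = x.
   The shears are chosen so that, outside a set Z of measure at most 1/8, a point
   y and its translate sigma y by half a period are merged by the backward flow:
   pi (sigma y) = pi y.  Let A be the half of the torus which sigma exchanges with
   its complement, and B a Borel set containing X_T^-1 A, of measure at most
   1/2 + 1/8.  As X_T preserves the measure, pi^-1 B has at most the measure of B
   and contains almost all of A, hence almost all of sigma A up to Z, hence
   almost everything outside Z: a contradiction. *)

From HB Require Import structures.
Require Import Defs.
From mathcomp Require Import all_boot all_order all_algebra.
From mathcomp Require Import generic_quotient ring_quotient.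
From mathcomp Require Import all_classical all_reals all_analysis.
From mathcomp Require Import measurable_realfun.
From mathcomp Require Import ring lra.

Set Implicit Arguments.
Unset Strict Implicit.
Unset Printing Implicit Defensive.

Import Order.TTheory GRing.Theory Num.Theory.
Import numFieldNormedType.Exports.
Local Open Scope classical_set_scope.
Local Open Scope ring_scope.

(** * The circle and a smoothed parity function *)

(** A shear is invertible, so no single step can close a gap for good; step n only trades gaps. The
    pair differs by [cell (n-1)] in the moving coordinate and by [cell n] in the resting one, up to
    sign. The resting gap flips [parity n], so one point moves by [cell (n-1)], which cancels the
    old gap, and the other by [cell (n+1)] up to sign, which leaves a gap smaller by q^2. That
    remainder is wanted: it must flip a parity when the coordinates exchange roles. Size q^(-n) at
    frequency q^n prevents decay in Lipschitz norm, but an exponent a < 1 leaves a gain q^(-(1-a)n).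
    The condition 2^(k+5) <= q^(1-a) spends it: k+1 factors 2^n go to the time scaling of the k-th
    derivative, two to vanishing like t^2 at t = 0, one to summation over slots, one to the
    smoothing of the sign. Smoothing is the price of continuity: signs are exact only outside
    transition layers, whose proportion [margin n] must be summable, so slopes gain 2^n. The layers
    are pulled back along the backward flow, and the assumed selection itself bounds the measure of
    these preimages. *)

Section circle_theory.
Variable R : realType.
Implicit Types x y : R.

Lemma circle_piP x y : circle_pi x = circle_pi y <-> x - y \is a Num.int.
Proof.
split.
  by move=> /eqmodP; rewrite /= Quotient.equivE.
by move=> xy; apply/eqmodP; rewrite /= Quotient.equivE.
Qed.

Lemma circle_piD x y : circle_pi (x + y) = circle_pi x + circle_pi y.
Proof. exact: Quotient.pi_add. Qed.

Lemma circle_reprK (z : circle R) : circle_pi (repr z) = z.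
Proof. by rewrite /circle_pi reprK. Qed.

Lemma circle_piDint x y : y \is a Num.int -> circle_pi (x + y) = circle_pi x.
Proof. by move=> yi; apply/circle_piP; rewrite addrAC subrr add0r. Qed.

Lemma circle_pi0 : circle_pi (0 : R) = 0.
Proof. by apply: (addrI (circle_pi 0)); rewrite -circle_piD !addr0. Qed.

Definition circle_fun (T : Type) (f : R -> T) (z : circle R) : T := f (repr z).

Lemma circle_funE (T : Type) (f : R -> T) x :
  (forall y (k : int), f (y + k%:~R) = f y) ->
  circle_fun f (circle_pi x) = f x.
Proof.
move=> fP; rewrite /circle_fun.
have /circle_piP/intrP[k xk] := circle_reprK (circle_pi x).
by rewrite -(subrK x (repr _)) xk addrC fP.
Qed.

End circle_theory.

Section wave.
Variable R : realType.
Implicit Types (x y t : R) (k : int).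

(** The distance to the set of even integers; the floor selects the nearest one. *)
Definition dist_even x : R := `|x - (Num.floor ((x + 1) / 2))%:~R * 2|.

Lemma dist_even_le1 x : dist_even x <= 1.
Proof.
have := floor_itv ((x + 1) / 2).
rewrite intrD /dist_even; set k : R := (Num.floor _)%:~R => /andP[h1 h2].
by rewrite ler_norml; apply/andP; split; lra.
Qed.

Lemma dist_even_le x k : dist_even x <= `|x - k%:~R * 2|.
Proof.
rewrite /dist_even; set m := Num.floor _.
have [->//|mk] := eqVneq m k.
apply: le_trans (dist_even_le1 x) _.
have /andP[] := floor_itv ((x + 1) / 2); rewrite -/m intrD => h1 h2.
have [lt_mk|lt_km] : (m < k \/ k < m)%R.
  by move: mk; rewrite neq_lt => /orP.
- have : m%:~R + 1 <= k%:~R :> R by rewrite -[1]/(1%:~R) -intrD ler_int lezD1.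
  move=> h; rewrite -normrN ger0_norm; lra.
- have : k%:~R + 1 <= m%:~R :> R by rewrite -[1]/(1%:~R) -intrD ler_int lezD1.
  move=> h; rewrite ger0_norm; lra.
Qed.

Lemma dist_evenE k x : `|x - k%:~R * 2| <= 1 -> dist_even x = `|x - k%:~R * 2|.
Proof.
move=> h; apply/eqP; rewrite eq_le dist_even_le/=.
rewrite /dist_even; set m := Num.floor _.
have [->//|mk] := eqVneq m k.
have /andP[] := floor_itv ((x + 1) / 2); rewrite -/m intrD => h1 h2.
have [lt_mk|lt_km] : (m < k \/ k < m)%R.
  by move: mk; rewrite neq_lt => /orP.
- have h3 : m%:~R + 1 <= k%:~R :> R by rewrite -[1]/(1%:~R) -intrD ler_int lezD1.
  by move: h; rewrite ler_norml => /andP[? ?]; lra.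
- have h3 : k%:~R + 1 <= m%:~R :> R by rewrite -[1]/(1%:~R) -intrD ler_int lezD1.
  apply: le_trans (h) _; move: h; rewrite ler_norml => /andP[? ?].
  by rewrite ler0_norm; lra.
Qed.

Lemma dist_even_lip x y : `|dist_even x - dist_even y| <= `|x - y|.
Proof.
have H u v : dist_even u - dist_even v <= `|u - v|.
  rewrite lerBlDr {2}/dist_even; set k := Num.floor _.
  apply: le_trans (dist_even_le u k) _.
  by apply: le_trans (ler_normD _ _); rewrite addrA subrK.
by rewrite ler_norml H andbT lerNl opprB distrC H.
Qed.

(** Triangle wave of period 2, with value 1 at even and -1 at odd integers. Its antiperiodicity
    under 1 is the source of every change of sign below. *)
Definition wave x : R := 1 - 2 * dist_even x.

Lemma waveD1 x : wave (x + 1) = - wave x.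
Proof.
have /andP[] := floor_itv ((x + 1) / 2); rewrite intrD.
rewrite /wave {2}/dist_even; set m := Num.floor _ => h1 h2.
have [x0|x0] := leP (x - m%:~R * 2) 0.
  have e : `|x + 1 - m%:~R * 2| = x + 1 - m%:~R * 2 by rewrite ger0_norm; lra.
  by rewrite (@dist_evenE m) e ?(ler0_norm x0); lra.
have e : `|x + 1 - (m + 1)%:~R * 2| = 1 - (x - m%:~R * 2).
  by rewrite intrD ler0_norm; lra.
by rewrite (@dist_evenE (m + 1)) e ?(gtr0_norm x0); lra.
Qed.

Lemma waveDnat (n : nat) x : wave (x + n%:R) = (-1) ^+ n * wave x.
Proof.
elim: n => [|n IH]; first by rewrite addr0 expr0 mul1r.
by rewrite -addn1 natrD addrA waveD1 IH addn1 exprS mulN1r mulNr.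
Qed.

Lemma wave_lip x y : `|wave x - wave y| <= 2 * `|x - y|.
Proof.
rewrite /wave (_ : _ - _ = 2 * (dist_even y - dist_even x)); last by lra.
by rewrite normrM ger0_norm// ler_pM2l// distrC dist_even_lip.
Qed.

Lemma wave_small t x : t <= 1 -> `|wave x| < t ->
  exists k, `|x - (k%:~R + 2^-1)| < t / 2.
Proof.
move=> t1; rewrite /wave /dist_even; set m := Num.floor _.
rewrite ltr_norml => /andP[h1 h2].
have [x0|x0] := leP (x - m%:~R * 2) 0.
  exists (m * 2 - 1); rewrite intrB intrM.
  by move: h1 h2; rewrite ler0_norm// => h1 h2; rewrite ltr_norml; lra.
exists (m * 2); rewrite intrM.
by move: h1 h2; rewrite gtr0_norm// => h1 h2; rewrite ltr_norml; lra.
Qed.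

Definition clamp t : R := Num.max (-1) (Num.min 1 t).

Lemma clampN t : clamp (- t) = - clamp t.
Proof.
rewrite /clamp; case: (leP 1 t); case: (leP 1 (- t)); rewrite ?maxEle ?minEle;
  do ?case: ifPn; rewrite -?ltNge; lra.
Qed.

Lemma clamp_le1 t : `|clamp t| <= 1.
Proof.
rewrite /clamp ler_norml !maxEle !minEle.
by do ?case: ifPn; rewrite -?ltNge; lra.
Qed.

Lemma clamp_abs1 t : 1 <= `|t| -> `|clamp t| = 1.
Proof.
rewrite /clamp; have [t0|t0] := leP 0 t => h.
  by rewrite ger0_norm// in h; rewrite min_l// max_r ?normr1//; lra.
rewrite ltr0_norm// in h; rewrite min_r; last lra.
by rewrite max_l ?normrN1//; lra.
Qed.

Lemma clamp_lip t u : `|clamp t - clamp u| <= `|t - u|.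
Proof.
wlog tu : t u / t <= u.
  move=> H; have [/H//|/ltW/H] := leP t u.
  by rewrite distrC (distrC u).
rewrite -normrN opprB -(normrN (t - u)) opprB (ger0_norm (_ : 0 <= u - t)) ?subr_ge0//.
rewrite /clamp !maxEle !minEle ler_norml.
by do !case: ifPn; rewrite -?ltNge; lra.
Qed.

End wave.

(** * Shear profiles: sign changes, size and regularity *)

Section profile.
Variables (R : realType) (q : nat).
Hypothesis q_odd : odd q.
Implicit Types (x y r : R) (m n : nat) (z : circle R).

Let q_gt0 : (0 < q)%N. Proof. by case: q q_odd. Qed.

Let q_ge1 : 1 <= q%:R :> R. Proof. by rewrite ler1n. Qed.

Let qX_gt0 n : 0 < q%:R ^+ n :> R.
Proof. by rewrite exprn_gt0// ltr0n. Qed.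

Definition cell n : R := (2 * q%:R ^+ n)^-1.

(** The value 0 replaces [cell (-1)]: a point and its half turn agree in the coordinate that moves
    first, so step 0 has no gap to cancel there. *)
Definition cell_pred n : R := if n is m.+1 then cell m else 0.

(** The factor 2^-n makes the transition layers summable. With three layers per step they total at
    most 6 * 2^-8, well within the 1/8 allowed to the exceptional set. *)
Definition margin n : R := (2 ^+ (n + 8))^-1.

(* [parity n] is a Lipschitz version of the sign which is (-1)^j on the interval of
   length [cell n] centred at j * [cell n]: it has modulus 1 except on a proportion
   [margin n] of each interval.  As q is odd, it changes sign under a shift by any
   [cell m] with m <= n. *)
Definition parity n x : R := clamp (wave (x * (2 * q%:R ^+ n)) / margin n).

(** Product of the Lipschitz constant 2 of [wave], the frequency 2 q^n and the slope 2^(n+8) of the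
    division by [margin n]. *)
Definition parity_lip n : R := 2 ^+ (n + 10) * q%:R ^+ n.

Lemma cell_gt0 n : 0 < cell n.
Proof. by rewrite invr_gt0 mulr_gt0. Qed.

Lemma margin_gt0 n : 0 < margin n.
Proof. by rewrite invr_gt0 exprn_gt0. Qed.

Lemma margin_le1 n : margin n <= 1.
Proof. by rewrite invf_le1 ?exprn_gt0// exprn_ege1// ler1n. Qed.

Lemma parity_le1 n x : `|parity n x| <= 1.
Proof. exact: clamp_le1. Qed.

Lemma parity_shift n m x : (m <= n)%N -> parity n (x + cell m) = - parity n x.
Proof.
move=> mn; rewrite /parity -clampN -mulNr; congr (clamp (_ / _)).
rewrite mulrDl (_ : cell m * _ = (q ^ (n - m))%:R).
  by rewrite waveDnat -signr_odd oddX q_odd orbT expr1 mulN1r.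
rewrite /cell -[in LHS](subnK mn) exprD natrX mulrA mulrC invfM.
rewrite !mulrA; field.
by rewrite lt0r_neq0// lt0r_neq0.
Qed.

Lemma parity_shiftM n m x r : (m <= n)%N -> `|r| = 1 ->
  parity n (x + r * cell m) = - parity n x.
Proof.
move=> mn; case: ger0P => [r0 ->|r0 r1]; first by rewrite mul1r parity_shift.
have -> : r = -1 by lra.
by rewrite mulN1r -[in RHS](subrK (cell m) x) parity_shift// opprK.
Qed.

Lemma parityDint n x (k : int) : parity n (x + k%:~R) = parity n x.
Proof.
have H (j : nat) y : parity n (y + j%:R) = parity n y.
  rewrite /parity [(y + _) * _]mulrDl (_ : j%:R * _ = (j * (2 * q ^ n))%:R :> R).
    by rewrite waveDnat -signr_odd oddM oddM andbF expr0 mul1r.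
  by rewrite !natrM natrX.
case: k => j; first exact: H.
by rewrite NegzE mulrNz -[in RHS](subrK (j.+1%:R : R) x) H.
Qed.

Lemma parity_lipP n x y : `|parity n x - parity n y| <= parity_lip n * `|x - y|.
Proof.
apply: le_trans (clamp_lip _ _) _; rewrite -mulrBl normrM normfV.
rewrite (gtr0_norm (margin_gt0 n)) /margin invrK.
apply: le_trans (ler_wpM2r _ (wave_lip _ _)) _; first by rewrite exprn_ge0.
rewrite -mulrBl normrM (gtr0_norm (_ : 0 < 2 * _))//; last by rewrite mulr_gt0.
rewrite /parity_lip !exprD le_eqVlt; apply/orP; left; apply/eqP; ring.
Qed.

Lemma parity_small n x : `|parity n x| < 1 ->
  exists k : int, `|x * (2 * q%:R ^+ n) - (k%:~R + 2^-1)| < margin n / 2.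
Proof.
move=> h; apply: wave_small (margin_le1 n) _; rewrite ltNge.
apply/negP => h1; move: h; rewrite clamp_abs1 ?ltxx//.
by rewrite normrM normfV (gtr0_norm (margin_gt0 n)) ler_pdivlMr ?margin_gt0// mul1r.
Qed.

(* On the set where |parity n| = 1 this is [cell (n-1)] where the parity is 1 (and 0
   instead, for n = 0), and +/- [cell (n+1)] where it is -1. *)
Definition profile n x : R :=
  (1 + parity n x) / 2 * cell_pred n +
  (1 - parity n x) / 2 * (cell n.+1 * parity n.+2 x).

Lemma profileDint n x (k : int) : profile n (x + k%:~R) = profile n x.
Proof. by rewrite /profile !parityDint. Qed.

Lemma cell_predE n : cell_pred n.+1 = q%:R * cell n.+1.
Proof.
rewrite /= /cell exprS; field.
by rewrite !lt0r_neq0// ltr0n.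
Qed.

Lemma cell_pred_ge0 n : 0 <= cell_pred n.
Proof. by case: n => //= n; rewrite ltW// cell_gt0. Qed.

Lemma cell_pred_le n : cell_pred n <= q%:R * cell n.
Proof. by case: n => [|n]; rewrite ?cell_predE//= mulr_ge0// ltW// cell_gt0. Qed.

Lemma cellS_le n : cell n.+1 <= q%:R * cell n.
Proof.
have := cell_predE n; rewrite /= => ->; rewrite mulrA.
by apply: ler_peMl; [exact: ltW (cell_gt0 _)|exact: mulr_ege1].
Qed.

Lemma profile_bound n x : `|profile n x| <= q%:R * cell n.
Proof.
have := parity_le1 n x; have := parity_le1 n.+2 x; rewrite /profile.
have := cell_pred_ge0 n; have := cell_pred_le n; have := cellS_le n.
have := cell_gt0 n.+1; move: (cell_pred n) (cell n.+1) (q%:R * _).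
move: (parity _ _) (parity _ _) => p p' b c M c0 cM bM b0.
rewrite !ler_norml => /andP[a1 a2] /andP[a3 a4].
have e1 : 0 <= (1 + p) * (M - b) by rewrite mulr_ge0//; lra.
have e2 : 0 <= (1 + p) * b by rewrite mulr_ge0//; lra.
have e3 : 0 <= (1 - p) * (M - c) by rewrite mulr_ge0//; lra.
have e4 : 0 <= (1 - p) * c * (1 - p') by rewrite !mulr_ge0//; lra.
have e5 : 0 <= (1 - p) * c * (1 + p') by rewrite !mulr_ge0//; lra.
by apply/andP; split; lra.
Qed.

Lemma profile_lip n x y : `|profile n x - profile n y| <=
  2 * (q%:R * cell n) * (parity_lip n.+2 * `|x - y|).
Proof.
have L : parity_lip n <= parity_lip n.+2.
  apply: ler_pM; rewrite ?exprn_ge0//; apply: ler_weXn2l;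
    by rewrite ?ler1n ?leq_add2r// (leq_trans (leqnSn n)).
have := parity_lipP n x y; have := parity_lipP n.+2 x y.
have {}L := ler_wpM2r (normr_ge0 (x - y)) L.
move=> h2 /le_trans /(_ L) h1; move: h1 h2.
have := parity_le1 n x; have := parity_le1 n.+2 y; rewrite /profile.
have := cell_pred_ge0 n; have := cell_pred_le n; have := cellS_le n.
have := cell_gt0 n.+1; move: (cell_pred n) (cell n.+1) (q%:R * _) (_ * `|_|).
move: (parity n x) (parity n.+2 x) (parity n y) (parity n.+2 y).
move=> p p' r r' b c M D c0 cM bM b0 hr' hp h1 h2.
(* Product rule in difference form. Since b and c are at most M, the two terms contribute D M / 2
   and 3 D M / 2, whence the factor 2 in the bound. *)
rewrite (_ : _ - _ = (p - r) * (b / 2) +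
  ((1 - p) * (p' - r') - (p - r) * r') * (c / 2)); last by field.
have D0 : 0 <= D by apply: le_trans h1.
apply: le_trans (ler_normD _ _) _; rewrite (normrM _ (b / 2)) (normrM _ (c / 2)).
rewrite (ger0_norm (_ : 0 <= b / 2)) ?(ger0_norm (_ : 0 <= c / 2)); [|lra..].
have hb : `|p - r| * (b / 2) <= D * (M / 2) by apply: ler_pM => //; lra.
have hc : `|(1 - p) * (p' - r') - (p - r) * r'| <= 3 * D.
  apply: le_trans (ler_normB _ _) _; rewrite !normrM.
  have h3 : `|1 - p| <= 2 by apply: le_trans (ler_normB _ _) _; rewrite normr1; lra.
  have h4 : `|1 - p| * `|p' - r'| <= 2 * D by apply: ler_pM.
  have h5 : `|p - r| * `|r'| <= D * 1 by apply: ler_pM.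
  lra.
have hd : `|(1 - p) * (p' - r') - (p - r) * r'| * (c / 2) <= (3 * D) * (M / 2).
  by apply: ler_pM => //; lra.
lra.
Qed.

Definition parity_circle n : circle R -> R := circle_fun (parity n).

Definition profile_circle n : circle R -> R := circle_fun (profile n).

Lemma parity_circle_shift n m z r : (m <= n)%N -> `|r| = 1 ->
  parity_circle n (z + circle_pi (r * cell m)) = - parity_circle n z.
Proof.
move=> mn r1; rewrite -{1}(circle_reprK z) -circle_piD.
rewrite /parity_circle circle_funE ?parity_shiftM//.
exact: parityDint.
Qed.

Lemma parity_circle_le1 n z : `|parity_circle n z| <= 1.
Proof. exact: parity_le1. Qed.

Lemma profile_circleE n z : profile_circle n z =
  (1 + parity_circle n z) / 2 * cell_pred n +
  (1 - parity_circle n z) / 2 * (cell n.+1 * parity_circle n.+2 z).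
Proof. by []. Qed.

Lemma norm1P r : `|r| = 1 -> r = 1 \/ r = -1.
Proof. by case: ger0P => _ <-; [left|right; rewrite opprK]. Qed.

(* A shear of the i-th coordinate by the profile of the j-th one takes a pair of
   points differing by (+/- cell (n-1), -/+ cell n) to a pair differing by
   (-/+ cell (n+1), +/- cell n), with the signs that the next step needs. *)
Lemma pair_step n (zi zj zi' zj' : circle R) :
  `|parity_circle n zj| = 1 -> `|parity_circle n.+2 zj| = 1 ->
  `|parity_circle n.+1 zi| = 1 ->
  zi' = zi + circle_pi (parity_circle n zj * cell_pred n) ->
  zj' = zj + circle_pi (- parity_circle n.+1 zi * cell n) ->
  let wi := zi + circle_pi (profile_circle n zj) in
  let wi' := zi' + circle_pi (profile_circle n zj') in
  zj' = zj + circle_pi (parity_circle n.+1 wi * cell_pred n.+1) /\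
  wi' = wi + circle_pi (- parity_circle n.+2 zj * cell n.+1).
Proof.
move=> h1 h2 h3 -> zj'E /=; split; last first.
  rewrite -!addrA -!circle_piD; congr (_ + circle_pi _).
  have e1 : parity_circle n zj' = - parity_circle n zj.
    by rewrite zj'E parity_circle_shift// normrN.
  have e2 : parity_circle n.+2 zj' = - parity_circle n.+2 zj.
    by rewrite zj'E parity_circle_shift ?normrN// ltnW.
  rewrite !profile_circleE e1 e2.
  by have [->|->] := norm1P h1; field.
(* The moving point is displaced by an odd multiple of [cell (n+1)], which reverses [parity n.+1].
   Only for n = 0 may the displacement vanish, and there the resting gap is 1/2, whose sign is
   invisible modulo 1. *)
rewrite zj'E; case: n h1 h2 h3 {zj'E} => [|n] h1 h2 h3.
  have c2 : cell 0 = 2^-1 by rewrite /cell expr0 mulr1.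
  congr (_ + _); apply/circle_piP; rewrite /= c2.
  set u := parity_circle 1 (_ + _).
  have : `|u| = 1.
    rewrite /u profile_circleE /= mulr0 add0r; have [->|->] := norm1P h1.
      by rewrite subrr !mul0r circle_pi0 addr0.
    rewrite [X in circle_pi X](_ : _ = parity_circle 2 zj * cell 1); last by field.
    by rewrite parity_circle_shift ?normrN.
  have [->|->] := norm1P h3 => /norm1P[->|->]; apply/intrP.
  - by exists (-1); rewrite mulrN1z; field.
  - by exists 0; rewrite mulr0z; field.
  - by exists 0; rewrite mulr0z; field.
  - by exists 1; rewrite mulr1z; field.
congr (_ + circle_pi (_ * _)).
rewrite profile_circleE; have [e|e] := norm1P h1; rewrite e.
  rewrite [X in circle_pi X](_ : _ = 1 * cell n); last by rewrite /=; field.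
  by rewrite parity_circle_shift ?normr1// ltnW.
rewrite [X in circle_pi X](_ : _ = parity_circle n.+3 zj * cell n.+2); last by field.
by rewrite parity_circle_shift.
Qed.

(** Interpolation between the sup norm and the Lipschitz constant: min(1, s) <= s^a with s = L t. *)
Lemma holder_of_lip (A L t D a : R) : 0 < a < 1 -> 0 <= A -> 0 <= L -> 0 <= t ->
  D <= 2 * A -> D <= 2 * A * (L * t) -> D <= 2 * A * (L `^ a * t `^ a).
Proof.
move=> /andP[a0 a1] A0 L0 t0 D1 D2; rewrite -powRM//.
have [Lt|Lt] := leP 1 (L * t).
  apply: le_trans D1 _; rewrite ler_peMr ?mulr_ge0//.
  rewrite [leLHS](_ : 1 = 1 `^ a); last by rewrite powR1.
  by rewrite ge0_ler_powR ?nnegrE// ?ltW// (lt_le_trans _ Lt).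
apply: le_trans D2 _; rewrite ler_wpM2l ?mulr_ge0//.
have [->|Lt0] := eqVneq (L * t) 0; first exact: powR_ge0.
by rewrite ger1_powR ?ltW// lt0r Lt0 mulr_ge0.
Qed.

(** For fixed q the sup norm is of order q^(-n) and the Lipschitz constant of order 2^n, so
    interpolation gives (2^a q^(a-1))^n. The assumption on q makes this ratio at most 2 *
    2^-(k+5). *)
Lemma profile_decay (a : R) (k : nat) : 0 < a < 1 ->
  2 ^+ (k + 5) <= q%:R `^ (1 - a) ->
  exists2 C, 0 < C & forall n x y,
    `|profile n x| <= C * (2 ^+ (k + 4))^-1 ^+ n /\
    `|profile n x - profile n y| <= C * (2 ^+ (k + 4))^-1 ^+ n * `|x - y| `^ a.
Proof.
move=> a01 hq; have /andP[a0 a1] := a01.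
have q0 : 0 < q%:R :> R by rewrite ltr0n.
pose K : R := (2 ^+ 12 * q%:R ^+ 2) `^ a.
have K0 : 0 <= K by exact: powR_ge0.
have rate1 : q%:R^-1 <= (2 ^+ (k + 4))^-1 :> R.
  rewrite lef_pV2 ?posrE ?exprn_gt0//.
  apply: le_trans (_ : 2 ^+ (k + 5) <= _); first by rewrite ler_weXn2l ?ler1n// leq_add2l.
  by apply: le_trans hq _; rewrite ler1_powR//; lra.
have rate2 : (2 * q%:R) `^ a / q%:R <= (2 ^+ (k + 4))^-1.
  rewrite powRM ?ler0n//.
  have e : q%:R `^ a / q%:R = (q%:R `^ (1 - a))^-1.
    rewrite -{2}[q%:R]powRr1// -powRB; last by apply/implyP; rewrite (gt_eqF q0).
    by rewrite -powRN opprB.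
  rewrite -mulrA e; apply: le_trans (_ : 2 * (2 ^+ (k + 5))^-1 <= _); last first.
    by rewrite addnS exprS invfM mulrA divff// mul1r.
  apply: ler_pM; rewrite ?powR_ge0 ?invr_ge0 ?powR_ge0//.
    by rewrite ler1_powR ?ler1n// ltW.
  by rewrite lef_pV2 ?posrE ?exprn_gt0// powR_gt0.
have cellE n : q%:R * cell n = q%:R / 2 * q%:R^-1 ^+ n.
  by rewrite /cell invfM exprVn mulrA.
exists (q%:R * K + q%:R); first by rewrite ltr_wpDl// mulr_ge0// ltW.
move=> n x y; split.
  apply: le_trans (profile_bound n x) _; rewrite cellE.
  apply: ler_pM; rewrite ?exprn_ge0 ?invr_ge0 ?divr_ge0 ?(ltW q0)//.
    have : 0 <= q%:R * K by rewrite mulr_ge0// ltW.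
    by move: q0; lra.
  by apply: lerXn2r => //; rewrite nnegrE invr_ge0 ?exprn_ge0 ?(ltW q0).
have A0 : 0 <= q%:R * cell n by rewrite mulr_ge0// ltW// cell_gt0.
have L0 : 0 <= parity_lip n.+2 by rewrite /parity_lip mulr_ge0// exprn_ge0.
have h1 : `|profile n x - profile n y| <= 2 * (q%:R * cell n).
  apply: le_trans (ler_normB _ _) _.
  by have := profile_bound n x; have := profile_bound n y; lra.
apply: le_trans (holder_of_lip a01 A0 L0 (normr_ge0 (x - y)) h1 (profile_lip n x y)) _.
rewrite mulrA ler_wpM2r ?powR_ge0//.
have -> : parity_lip n.+2 `^ a = K * ((2 * q%:R) `^ a) ^+ n.
  rewrite -powR_mulrn ?powR_ge0// -powRrM [a * _]mulrC powRrM powR_mulrn ?mulr_ge0//.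
  rewrite -powRM ?mulr_ge0 ?exprn_ge0 ?mulr_ge0//; congr (_ `^ _).
  rewrite /parity_lip (_ : n.+2 + 10 = 12 + n)%N; last by rewrite addnC.
  rewrite (exprD _ 12 n) (exprD _ 2 n : q%:R ^+ n.+2 = _) exprMn.
  by rewrite mulrACA.
rewrite cellE.
rewrite [leLHS](_ : _ = q%:R * K * ((2 * q%:R) `^ a / q%:R) ^+ n); last first.
  by rewrite exprMn; field.
apply: ler_pM; rewrite ?mulr_ge0 ?exprn_ge0 ?divr_ge0 ?powR_ge0 ?(ltW q0)//.
  by rewrite lerDl ltW.
by apply: lerXn2r => //; rewrite nnegrE ?divr_ge0 ?powR_ge0 ?invr_ge0 ?exprn_ge0 ?(ltW q0).
Qed.

Lemma lip_continuous (f : R -> R) (L : R) :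
  (forall x y, `|f x - f y| <= L * `|x - y|) -> continuous f.
Proof.
move=> fL x; apply/cvgrPdist_le => e e0; near=> y.
apply: le_trans (fL x y) _.
apply: le_trans (_ : (`|L| + 1) * `|x - y| <= _).
  by rewrite ler_wpM2r// (le_trans (ler_norm L))// lerDl.
rewrite -ler_pdivlMl ?ltr_wpDl//; near: y.
by apply: cvgr_dist_le => //; rewrite mulr_gt0// invr_gt0 ltr_wpDl.
Unshelve. all: by end_near. Qed.

Lemma measurable_circle_fun (f : R -> R) :
  (forall x (k : int), f (x + k%:~R) = f x) -> measurable_fun setT f ->
  measurable_fun [set: circle R] (circle_fun f).
Proof.
move=> fP mf _ A mA; rewrite setTI /measurable/= /circle_borel/=.
rewrite (_ : _ @^-1` _ = f @^-1` A); first by rewrite -[X in measurable X]setTI; exact: mf.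
by apply/funext => x; rewrite /preimage/= circle_funE.
Qed.

Lemma measurable_parity_circle n : measurable_fun setT (parity_circle n).
Proof.
apply: measurable_circle_fun; first exact: parityDint.
by apply: continuous_measurable_fun; apply: lip_continuous (parity_lipP n).
Qed.

Lemma measurable_profile_circle n : measurable_fun setT (profile_circle n).
Proof.
apply: measurable_circle_fun; first exact: profileDint.
apply: continuous_measurable_fun.
apply: (@lip_continuous _ (2 * (q%:R * cell n) * parity_lip n.+2)) => x y.
by rewrite -mulrA; exact: profile_lip.
Qed.

Definition transition n : set (circle R) := [set z | `|parity_circle n z| < 1].

Lemma measurable_transition n : measurable (transition n).
Proof.
have mp : measurable_fun setT (fun z => `|parity_circle n z|).
  exact: measurableT_comp (measurable_parity_circle n).
rewrite (_ : transition n =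
  setT `&` (fun z => `|parity_circle n z|) @^-1` `]-oo, 1[%classic).
  exact: mp.
by rewrite setTI; apply/seteqP; split => z /=; rewrite in_itv.
Qed.

(** In the variable 2 q^n x the layers surround the points k + 1/2. A period meets 2 q^n of them,
    each of length [margin n] / (2 q^n). *)
Lemma transition_measure n :
  (circle_measure (transition n) <= (margin n)%:E)%E.
Proof.
rewrite /circle_measure /pushforward /mrestr.
pose N := (2 * q ^ n)%N; pose c : R := (2 * q%:R ^+ n).
have NE : N%:R = c by rewrite /N natrM natrX.
have c0 : 0 < c by rewrite mulr_gt0.
pose I (i : nat) : set R := `](i%:R + 2^-1 - margin n / 2) / c, (i%:R + 2^-1 + margin n / 2) / c[%classic.
have sub : (circle_pi (R:=R)) @^-1` transition n `&` `[0, 1[ `<=` \big[setU/set0]_(i < N) I i.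
  move=> x [/=]; rewrite /transition/= /parity_circle circle_funE; last exact: parityDint.
  move=> /parity_small[k]; rewrite -/c ltr_norml => /andP[k1 k2].
  rewrite in_itv/= => /andP[x0 x1].
  have m1 := margin_le1 n.
  have xc0 : 0 <= x * c by rewrite mulr_ge0// ltW.
  have xc1 : x * c < c by rewrite gtr_pMl.
  have k0 : (0 <= k)%R.
    by rewrite -(ltzD1) -(ltr_int R) intrD; lra.
  have kN : (k < N)%R.
    rewrite -(ltr_int R) -pmulrn NE; lra.
  move: k k0 kN k1 k2 => [k|//] _; rewrite ltz_nat => kN k1 k2.
  rewrite -bigcup_mkord; exists k => //=.
  rewrite -pmulrn in k1 k2.
  by rewrite /I /= in_itv/= ltr_pdivrMr// ltr_pdivlMr//; lra.
have mI i : measurable (I i) by exact: measurable_itv.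
apply: le_trans (le_measure lebesgue_measure _ _ sub) _.
- rewrite inE; apply: measurableI; last exact: measurable_itv.
  by rewrite -[X in _ X]setTI; apply: measurable_circle_pi => //; exact: measurable_transition.
- rewrite inE; apply: bigsetU_measurable => i _; exact: mI.
apply: le_trans (Boole_inequality lebesgue_measure (fun i _ => mI i)) _.
rewrite (eq_bigr (fun=> (margin n / c)%:E)); last first.
  move=> i _; apply: eq_trans (lebesgue_measure_itv _) _.
  rewrite /= lte_fin ltr_pM2r ?invr_gt0//.
  have m0 := margin_gt0 n.
  rewrite ifT; last by lra.
  by rewrite -EFinD; congr EFin; rewrite -mulrBl; congr (_ / _); field.
rewrite sumEFin lee_fin sumr_const card_ord -mulr_natl NE mulrCA divff ?mulr1//.
by rewrite lt0r_neq0.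
Qed.

End profile.

(** * Time profiles *)

Section pulse.
Variable R : realType.
Implicit Types (Q A : {poly R}) (s t : R) (j k n : nat).

Definition cutoff Q s : R := if 0 < s < 1 then Q.[s] else 0.

Lemma cutoff_le Q s : `|cutoff Q s| <= `|Q.[s]|.
Proof. by rewrite /cutoff; case: ifP; rewrite ?normr0. Qed.

Lemma cutoff_in Q s : Q.[0] = 0 -> Q.[1] = 0 -> 0 <= s <= 1 ->
  cutoff Q s = Q.[s].
Proof.
move=> Q0 Q1 /andP[s0 s1]; rewrite /cutoff; case: ifPn => //.
rewrite negb_and -!leNgt => /orP[h|h].
  by rewrite (_ : s = 0) ?Q0//; lra.
by rewrite (_ : s = 1) ?Q1//; lra.
Qed.

Lemma cutoff_cases s :
  [\/ s = 0, s = 1, 0 < s < 1 | s < 0 \/ 1 < s].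
Proof.
have [h|h|->] := ltgtP s 0; [by apply: Or44; left| |by apply: Or41].
by have [h'|h'|->] := ltgtP s 1; [apply: Or43|apply: Or44; right|apply: Or42].
Qed.

Lemma cutoff_near_in Q s : 0 < s < 1 -> \near s, horner Q s = cutoff Q s.
Proof.
move=> /andP[s0 s1]; near=> t.
by rewrite /cutoff ifT//; apply/andP; split; near: t; [exact: lt_nbhsr|exact: lt_nbhsl].
Unshelve. all: by end_near. Qed.

Lemma cutoff_near_out Q s : s < 0 \/ 1 < s -> \near s, cst 0 s = cutoff Q s.
Proof.
move=> [s0|s1]; near=> t.
  rewrite /cutoff ifF//; apply/negbTE; rewrite negb_and -!leNgt; apply/orP; left.
  by apply: ltW; near: t; exact: lt_nbhsl.
rewrite /cutoff ifF//; apply/negbTE; rewrite negb_and -!leNgt; apply/orP; right.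
by apply: ltW; near: t; exact: lt_nbhsr.
Unshelve. all: by end_near. Qed.

Lemma is_derive_cutoff Q s : Q.[0] = 0 -> Q.[1] = 0 ->
  Q^`().[0] = 0 -> Q^`().[1] = 0 ->
  is_derive s 1 (cutoff Q) (cutoff Q^`() s).
Proof.
move=> Q0 Q1 dQ0 dQ1.
(* At an end point [Q] and [cutoff Q] both vanish, so [cutoff_le] bounds the difference quotients of
   [cutoff Q] by those of [Q], which tend to 0. *)
have bd : Q.[s] = 0 -> Q^`().[s] = 0 -> cutoff Q s = 0 -> cutoff Q^`() s = 0 ->
    is_derive s 1 (cutoff Q) (cutoff Q^`() s).
  move=> Qs dQs cs dcs.
  have [dQ vQ] := is_derive_poly Q s.
  have cv : h^-1 *: (Q.[h *: 1 + s] - Q.[s]) @[h --> 0^'] --> Q^`().[s].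
    by rewrite -vQ; exact: dQ.
  rewrite dQs in cv.
  have cv2 : h^-1 *: (cutoff Q (h *: 1 + s) - cutoff Q s) @[h --> 0^'] --> (0 : R).
    move: cv => /cvgr0Pnorm_le cv; apply/cvgr0Pnorm_le => e e0.
    near=> h; apply: le_trans (_ : `|h^-1 *: (Q.[h *: 1 + s] - Q.[s])| <= _).
      by rewrite !normrZ Qs cs !subr0 ler_wpM2l// cutoff_le.
    by near: h; exact: cv.
  rewrite dcs; apply: DeriveDef; first by apply/cvg_ex; exists 0.
  exact/cvg_lim.
case: (cutoff_cases s) => [s0|s1|h|h].
- by apply: bd; rewrite ?s0// /cutoff ltxx.
- by apply: bd; rewrite ?s1// /cutoff ltxx andbF.
- rewrite [cutoff Q^`() s]/cutoff h.
  exact: near_eq_is_derive (cutoff_near_in Q h) (is_derive_poly Q s).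
- rewrite -(nbhs_singleton (cutoff_near_out Q^`() h)).
  exact: near_eq_is_derive (cutoff_near_out Q h) (is_derive_cst _ _ _).
Unshelve. all: by end_near. Qed.

Lemma continuous_cutoff Q : Q.[0] = 0 -> Q.[1] = 0 -> continuous (cutoff Q).
Proof.
move=> Q0 Q1 s.
have bd : Q.[s] = 0 -> cutoff Q s = 0 -> cutoff Q @ s --> cutoff Q s.
  move=> Qs ->; have : horner Q @ s --> Q.[s] by exact: continuous_horner.
  rewrite Qs => /cvgr0Pnorm_le cv; apply/cvgr0Pnorm_le => e e0.
  near=> h; apply: le_trans (cutoff_le _ _) _.
  by near: h; exact: cv.
case: (cutoff_cases s) => [s0|s1|h|h].
- by apply: bd; rewrite ?s0// /cutoff ltxx.
- by apply: bd; rewrite ?s1// /cutoff ltxx andbF.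
- rewrite /continuous_at -(nbhs_singleton (cutoff_near_in Q h)).
  apply: cvg_trans (@continuous_horner _ Q s).
  by apply: near_eq_cvg; apply: filterS (cutoff_near_in Q h) => ? ->.
- rewrite /continuous_at -(nbhs_singleton (cutoff_near_out Q h)).
  apply: cvg_trans (@cst_continuous _ _ 0 s).
  by apply: near_eq_cvg; apply: filterS (cutoff_near_out Q h) => ? <-.
Unshelve. all: by end_near. Qed.

(* Increases from 0 to 1 on [0, 1], with derivatives of orders 1 to k + 1 vanishing
   at both ends. *)
Definition ramp k : {poly R} := 1 - (1 - 'X^(k.+2)) ^+ k.+2.

Lemma ramp0 k : (ramp k).[0] = 0.
Proof. by rewrite /ramp !hornerE expr0n/= subr0 expr1n subrr. Qed.

Lemma ramp1 k : (ramp k).[1] = 1.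
Proof. by rewrite /ramp !hornerE expr1n subrr expr0n/= subr0. Qed.

(** The base of the power vanishes at 0 and at 1, so both are roots of multiplicity at least k+1 of
    the derivative. *)
Lemma deriv_ramp k :
  (ramp k)^`() = ('X - 'X^(k.+3)) ^+ k.+1 * ((k.+2 * k.+2)%:R)%:P.
Proof.
rewrite /ramp derivB deriv_exp derivB derivXn -[1]/(1%:P) derivC !sub0r.
have -> : 'X - 'X^(k.+3) = 'X * (1%:P - 'X^(k.+2)) :> {poly R}.
  by rewrite mulrBr mulr1 -exprS.
rewrite exprMn polyC_natr mulr_natr /=.
by rewrite mulNr mulNrn opprK mulrnAl -mulrnA.
Qed.

(** Each differentiation costs one power of A. Applied to A = X - X^(k+3), this keeps 0 and 1 as
    roots of the higher derivatives of [ramp]. *)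
Lemma derivn_exp_factor A Q j n :
  exists Q', (A ^+ (n + j) * Q)^`(j) = A ^+ n * Q'.
Proof.
elim: j n Q => [|j IH] n Q; first by exists Q; rewrite addn0 derivn0.
have [Q' E] := IH n.+1 Q.
rewrite addnS -addSn derivnS E derivM deriv_exp /=.
exists (A^`() * Q' *+ n.+1 + A * Q'^`()).
rewrite mulrDr mulrnAr mulrnAl; congr (_ *+ _ + _).
  by rewrite mulrCA mulrA.
by rewrite mulrA -exprSr.
Qed.

(** The count starts at the first derivative of [ramp], so that [pulse k 0] has integral ramp(1) -
    ramp(0) = 1 and j counts the derivatives of this pulse. *)
Definition pulse k j s : R := cutoff (ramp k)^`(j.+1) s.

Lemma derivn_ramp_root k j s : (j <= k)%N -> s = 0 \/ s = 1 ->
  (ramp k)^`(j.+1).[s] = 0.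
Proof.
move=> jk s01; rewrite derivSn deriv_ramp.
rewrite [X in _ ^+ X](_ : k.+1 = (k - j).+1 + j)%N; last by rewrite addSn subnK.
have [Q' ->] := derivn_exp_factor ('X - 'X^(k.+3)) ((k.+2 * k.+2)%:R)%:P j (k - j).+1.
rewrite hornerM horner_exp !hornerE.
by case: s01 => ->; rewrite ?expr1n ?subrr ?[0 ^+ k.+3]expr0n ?subr0 expr0n mul0r.
Qed.

Lemma is_derive_pulse k j s : (j < k)%N ->
  is_derive s 1 (pulse k j) (pulse k j.+1 s).
Proof.
move=> jk; have h0 := @derivn_ramp_root k _ 0 _ (or_introl erefl).
have h1 := @derivn_ramp_root k _ 1 _ (or_intror erefl).
rewrite /pulse [X in cutoff X s]derivnS.
apply: is_derive_cutoff.
- exact/h0/ltnW.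
- exact/h1/ltnW.
- by rewrite -derivnS; exact: h0.
- by rewrite -derivnS; exact: h1.
Qed.

Lemma continuous_pulse k j : (j <= k)%N -> continuous (pulse k j).
Proof.
move=> jk; apply: continuous_cutoff; rewrite derivn_ramp_root//; first [by left|by right].
Qed.

Lemma poly_bounded Q : exists2 M, 0 < M & forall s, 0 <= s <= 1 -> `|Q.[s]| <= M.
Proof.
exists (\sum_(i < size Q) `|Q`_i| + 1).
  by rewrite ltr_wpDl// sumr_ge0.
move=> s /andP[s0 s1]; rewrite horner_coef.
apply: le_trans (ler_norm_sum _ _ _) _; apply: le_trans (_ : _ <= \sum_(i < size Q) `|Q`_i|) _; last by rewrite lerDl.
apply: ler_sum => i _; rewrite normrM ler_piMr// normrX ger0_norm//.
exact: exprn_ile1.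
Qed.

Lemma pulse_bounded k : exists2 M, 0 < M & forall j s, (j <= k)%N -> `|pulse k j s| <= M.
Proof.
suff : forall m, exists2 M, 0 < M & forall j s, (j < m)%N -> `|pulse k j s| <= M.
  by move=> /(_ k.+1).
elim=> [|m [M M0 IH]]; first by exists 1.
have [N N0 hN] := poly_bounded (ramp k)^`(m.+1).
exists (M + N); first by rewrite addr_gt0.
move=> j s; rewrite ltnS leq_eqVlt => /orP[/eqP->|/IH h]; last first.
  by apply: le_trans (h s) _; rewrite lerDl ltW.
rewrite /pulse /cutoff; case: ifPn => [/andP[s0 s1]|]; last first.
  by rewrite normr0 addr_ge0// ltW.
apply: le_trans (hN s _) _; first by rewrite !ltW.
by rewrite lerDr ltW.
Qed.

End pulse.

Lemma is_derive_slope (R : realType) (f : R -> R) (t df : R) :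
  is_derive t 1 f df -> (s - t)^-1 * (f s - f t) @[s --> t^'] --> df.
Proof.
move=> [df1 <-].
have h0 : s - t @[s --> t^'] --> 0^'.
  move=> A /= [e /= e0 eA]; exists e => //= s ts st.
  by apply: eA; rewrite /= ?sub0r ?opprB// subr_eq0.
have := cvg_comp _ _ h0 df1; apply: cvg_trans; apply: near_eq_cvg.
by apply: nearW => s /=; rewrite scaler1 subrK.
Qed.

(** * Superposition of the slots and regularity up to the singular time *)

Section time_series.
Variables (R : realType) (E : normedModType R) (T : R) (k : nat) (v : nat -> E).
Hypothesis T_gt0 : 0 < T.
Variable C : R.
Hypothesis C_ge0 : 0 <= C.
Hypothesis v_le : forall n, `|v n| <= C * (2 ^+ (k + 4))^-1 ^+ n.
Implicit Types (t s : R) (j n : nat).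

Definition slot_scale n : R := 2 ^+ n.+1 / T.

(** The affine map t * [slot_scale n] - 1 sends [T/2^(n+1), T/2^n] onto [0, 1]. In the exponent j+1,
    j comes from the chain rule and 1 keeps the time integral of the pulse equal to 1. *)
Definition time_coef j n t : R :=
  pulse k j (t * slot_scale n - 1) * slot_scale n ^+ j.+1.

(* For t <= 0 this is 1, which is harmless since all coefficients then vanish. *)
Definition slot_count t : nat := (Num.truncn (T / t)).+1.

Definition time_series j t : E :=
  \sum_(n < slot_count t) time_coef j n t *: v n.

Lemma slot_scale_gt0 n : 0 < slot_scale n.
Proof. by rewrite divr_gt0// exprn_gt0. Qed.

Lemma time_coef_out j n t : t * slot_scale n <= 1 \/ 2 <= t * slot_scale n ->
  time_coef j n t = 0.
Proof.
move=> h; rewrite /time_coef /pulse /cutoff ifF ?mul0r//; apply/negbTE.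
by rewrite negb_and -!leNgt; apply/orP; case: h => h; [left|right]; lra.
Qed.

Lemma time_coef_slot_count j n t : (slot_count t <= n)%N -> time_coef j n t = 0.
Proof.
move=> tn; apply: time_coef_out; have [t0|t0] := leP t 0; [left|right].
  by apply: le_trans (_ : 0 <= _) => //; rewrite mulr_le0_ge0// ltW// slot_scale_gt0.
(* From T/t < [slot_count t] <= n < 2^n: time t lies beyond the end T/2^n of slot n. *)
have h : T / t < 2 ^+ n.
  have h1 : T / t < (slot_count t)%:R by exact: truncnS_gt.
  apply: lt_le_trans h1 _; rewrite -natrX ler_nat.
  by apply: leq_trans tn _; apply: ltnW; exact: ltn_expl.
rewrite ltr_pdivrMr// in h.
by rewrite /slot_scale mulrA ler_pdivlMr// exprS; lra.
Qed.

Lemma time_seriesE j t N : (slot_count t <= N)%N ->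
  time_series j t = \sum_(n < N) time_coef j n t *: v n.
Proof.
move=> tN; rewrite /time_series -(subnKC tN) big_split_ord /=.
rewrite [X in _ = _ + X]big1 ?addr0// => i _.
by rewrite time_coef_slot_count ?scale0r// leq_addr.
Qed.

Lemma is_derive_time_coef j n t : (j < k)%N ->
  is_derive t 1 (time_coef j n) (time_coef j.+1 n t).
Proof.
move=> jk; pose g : R -> R := slot_scale n \*: (@id R) - cst 1.
have gE s : g s = s * slot_scale n - 1 by rewrite /g /= mulrC.
have h1 : is_derive t 1 g (slot_scale n).
  by apply: is_derive_eq; rewrite subr0 [_ *: _]mulr1.
have h2 := is_derive_pulse (g t) jk.
have h3 := @is_derive1_comp R (pulse k j) g t _ _ h2 h1.
have -> : time_coef j n = slot_scale n ^+ j.+1 \*: (pulse k j \o g).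
  by apply/funext => s /=; rewrite /time_coef -gE [RHS]mulrC.
apply: is_derive_eq (is_deriveZ _ h3) _.
by rewrite /time_coef -gE [LHS]mulrC -mulrA -exprS.
Qed.

Lemma continuous_time_coef j n : (j <= k)%N -> continuous (time_coef j n).
Proof.
move=> jk t; apply: cvgM; last exact: cvg_cst.
apply: (@continuous_comp _ _ _ (fun s => s * slot_scale n - 1) (pulse k j)); last exact: continuous_pulse.
by apply: cvgB; [apply: cvgM; [exact: cvg_id|exact: cvg_cst]|exact: cvg_cst].
Qed.

Lemma slot_count_near t : t != 0 ->
  exists N, \forall s \near t, (slot_count s <= N)%N.
Proof.
have [t0 _|t0 _|_ //] := ltgtP t 0.
  exists 1%N; near=> s; rewrite /slot_count ltnS truncn_le_nat.
  have s0 : s < 0 by near: s; exact: lt_nbhsl.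
  by apply: lt_trans (_ : 0 < _) => //; rewrite pmulr_rlt0// invr_lt0.
exists (slot_count (t / 2)); near=> s.
have ts : t / 2 < s by near: s; apply: lt_nbhsr; rewrite ltr_pdivrMr// ltr_pMr// ltr1n.
have s0 : 0 < s by apply: lt_trans ts; rewrite divr_gt0.
rewrite /slot_count ltnS; apply/le_truncn.
by rewrite ler_pM2l// lef_pV2 ?posrE ?divr_gt0// ltW.
Unshelve. all: by end_near. Qed.

Lemma time_series_nonpos j t : t <= 0 -> time_series j t = 0.
Proof.
move=> t0; rewrite /time_series big1// => n _.
rewrite time_coef_out ?scale0r//; left.
by apply: le_trans (_ : 0 <= _) => //; rewrite mulr_le0_ge0// ltW// slot_scale_gt0.
Qed.

(** The time scaling costs k+1 factors 2^n, so the decay of [v] leaves 2^(-3n). For t > 0, a nonzero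
    coefficient forces 2^(-n) <= 2 t / T: two factors produce t^2 and the third sums the series. *)
Lemma time_series_small : exists2 K, 0 <= K & forall j t, (j <= k)%N ->
  `|time_series j t| <= K * t ^+ 2.
Proof.
have [B B0 hB] := pulse_bounded R k.
pose S : R := 2 / T + 1.
have S0 : 0 < S by rewrite addr_gt0// divr_gt0.
pose K := B * S ^+ k.+1 * C * (2 / T) ^+ 2.
have T0 := ltW T_gt0; have B0' := ltW B0; have S0' := ltW S0.
have K0 : 0 <= K.
  by rewrite /K; do ?[apply: divr_ge0 => // | apply: mulr_ge0 => // | apply: exprn_ge0 => //].
have term j t n : (j <= k)%N -> 0 < t ->
    `|time_coef j n t *: v n| <= K * t ^+ 2 * 2^-1 ^+ n.
  move=> jk t0; rewrite normrZ.
  have [h|h] := leP (t * slot_scale n) 1.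
    rewrite time_coef_out ?normr0 ?mul0r; last by left.
    by rewrite mulr_ge0 ?mulr_ge0 ?exprn_ge0 ?invr_ge0 ?(ltW t0).
  have P0 : 0 < 2 ^+ n :> R by rewrite exprn_gt0.
  have P1 : 1 <= 2 ^+ n :> R by rewrite exprn_ege1// ler1n.
  have sS : slot_scale n <= S * 2 ^+ n.
    rewrite /slot_scale /S exprS mulrAC [(2 / T + 1) * _]mulrDl mul1r.
    by rewrite lerDl ltW.
  have SP : 1 <= S * 2 ^+ n.
    by rewrite mulr_ege1// /S lerDr divr_ge0// ltW.
  have c1 : `|time_coef j n t| <= B * (S * 2 ^+ n) ^+ k.+1.
    rewrite /time_coef normrM ler_pM// ?hB// ger0_norm ?exprn_ge0 ?(ltW (slot_scale_gt0 n))//.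
    apply: le_trans (_ : (S * 2 ^+ n) ^+ j.+1 <= _).
      by apply: lerXn2r => //; rewrite nnegrE ltW ?slot_scale_gt0 ?mulr_gt0.
    by apply: ler_weXn2l.
  apply: le_trans (_ : (B * (S * 2 ^+ n) ^+ k.+1) * (C * (2 ^+ (k + 4))^-1 ^+ n) <= _).
    by apply: ler_pM.
  have Pt : 2^-1 ^+ n <= 2 / T * t.
    rewrite exprVn -[leLHS]mul1r ler_pdivrMr// ltW//.
    apply: lt_le_trans h _; rewrite /slot_scale exprS le_eqVlt; apply/orP; left.
    by apply/eqP; field; rewrite lt0r_neq0.
  have Pt2 : (2^-1 ^+ n) ^+ 2 <= (2 / T) ^+ 2 * t ^+ 2.
    rewrite -exprMn; apply: lerXn2r => //; rewrite nnegrE.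
      by rewrite exprn_ge0// invr_ge0.
    by rewrite mulr_ge0 ?divr_ge0// ltW.
  rewrite [leLHS](_ : _ = B * S ^+ k.+1 * C * ((2^-1 ^+ n) ^+ 2 * 2^-1 ^+ n)); last first.
    rewrite exprMn [in X in _ * (C * X)]exprVn -exprM mulnC exprM exprD exprVn.
    rewrite [(2 ^+ n) ^+ k.+1]exprS.
    have : (2 ^+ n) ^+ k != 0 :> R by rewrite lt0r_neq0// exprn_gt0.
    move: (_ ^+ k) (_ ^+ k.+1) => w z w0.
    by field; rewrite w0 lt0r_neq0.
  rewrite [leRHS](_ : _ = B * S ^+ k.+1 * C * ((2 / T) ^+ 2 * t ^+ 2 * 2^-1 ^+ n)); last first.
    by rewrite /K !mulrA.
  rewrite ler_wpM2l ?ler_wpM2r ?exprn_ge0 ?invr_ge0//.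
  by rewrite mulr_ge0 ?mulr_ge0 ?exprn_ge0.
exists (K * 2); first by rewrite mulr_ge0.
move=> j t jk; have [t0|t0] := leP t 0.
  rewrite time_series_nonpos// normr0. by apply: mulr_ge0; [exact: mulr_ge0|exact: sqr_ge0].
apply: le_trans (ler_norm_sum _ _ _) _.
apply: le_trans (_ : \sum_(n < slot_count t) K * t ^+ 2 * 2^-1 ^+ n <= _).
  by apply: ler_sum => n _; exact: term.
rewrite -mulr_sumr [leRHS]mulrAC; apply: ler_wpM2l; first by rewrite mulr_ge0 ?sqr_ge0.
have G N : \sum_(n < N) 2^-1 ^+ n = 2 - 2 * 2^-1 ^+ N :> R.
  elim: N => [|N IH]; first by rewrite big_ord0 expr0; lra.
  by rewrite big_ord_recr/= IH exprS; lra.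
by rewrite G lerBlDr lerDl mulr_ge0// exprn_ge0// invr_ge0.
Qed.

Lemma cvg0_of_le (F : set_system R) (FF : Filter F) (f : R -> E) (K : R) :
  0 <= K -> s @[s --> F] --> (0 : R) -> (\forall s \near F, `|f s| <= K * `|s|) ->
  f s @[s --> F] --> (0 : E).
Proof.
move=> K0 F0 fK; apply/cvgr0Pnorm_le => e e0; near=> s.
apply: le_trans (_ : K * `|s| <= _); first by near: s.
apply: le_trans (_ : (K + 1) * `|s| <= _); first by rewrite ler_wpM2r// lerDl.
rewrite -ler_pdivlMl ?ltr_wpDl//; near: s.
by move/cvgr0_norm_le : F0; apply; rewrite mulr_gt0// invr_gt0 ltr_wpDl.
Unshelve. all: by end_near. Qed.

Lemma time_series_cvg_slope j t : (j < k)%N ->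
  (s - t)^-1 *: (time_series j s - time_series j t) @[s --> t^']
    --> time_series j.+1 t.
Proof.
(* At the singular time the quadratic bound makes the slopes tend to 0. Elsewhere a fixed number N
   of terms is enough near t, and differentiation is termwise. *)
move=> jk; have [->|t0] := eqVneq t 0.
  rewrite !(@time_series_nonpos _ 0)//.
  have [K K0 hK] := time_series_small.
  apply: (@cvg0_of_le _ _ _ K) => //; first exact: cvg_within.
  near=> s; rewrite !subr0 normrZ normfV.
  have s0 : s != 0 by near: s; exact: nbhs_dnbhs_neq.
  rewrite ler_pdivrMl ?normr_gt0//.
  apply: le_trans (hK j s (ltnW jk)) _.
  by rewrite [leRHS]mulrCA -expr2 real_normK// num_real.
have [N tN] := slot_count_near t0.
rewrite (@time_seriesE _ _ N) ?(nbhs_singleton tN)//.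
rewrite (@time_seriesE j.+1 t N) ?(nbhs_singleton tN)//.
have cv : \sum_(n < N) ((s - t)^-1 * (time_coef j n s - time_coef j n t)) *: v n @[s --> t^']
    --> \sum_(n < N) time_coef j.+1 n t *: v n.
  apply: cvg_big => [|n _]; [exact: add_continuous|apply: cvgZr_tmp].
  by apply: is_derive_slope; exact: is_derive_time_coef.
apply: cvg_trans cv; apply: near_eq_cvg; near=> s.
rewrite (@time_seriesE j s N); last by near: s; apply: cvg_within tN.
rewrite -sumrB scaler_sumr; apply: eq_bigr => n _.
by rewrite -scalerA scalerBl.
Unshelve. all: by end_near. Qed.

Lemma continuous_time_series j : (j <= k)%N -> continuous (time_series j).
Proof.
move=> jk t; rewrite /continuous_at; have [->|t0] := eqVneq t 0.
  rewrite (@time_series_nonpos _ 0)//.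
  have [K K0 hK] := time_series_small.
  apply: (@cvg0_of_le _ _ _ K) => //.
  near=> s; apply: le_trans (hK j s jk) _; rewrite ler_wpM2l//.
  have s1 : `|s| <= 1 by near: s; exact: (@nbhs0_le R R 1 ltr01).
  by rewrite -real_normK ?num_real// expr2 ler_piMr.
have [N tN] := slot_count_near t0.
rewrite (@time_seriesE _ _ N) ?(nbhs_singleton tN)//.
have cv : \sum_(n < N) time_coef j n s *: v n @[s --> t]
    --> \sum_(n < N) time_coef j n t *: v n.
  by apply: cvg_big => [|n _]; [exact: add_continuous|apply: cvgZr_tmp]; exact: continuous_time_coef.
apply: cvg_trans cv; apply: near_eq_cvg; near=> s.
by rewrite (@time_seriesE j s N)//; near: s.
Unshelve. all: by end_near. Qed.

Lemma Ck_time_series : Ck_on 0 T k (time_series 0).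
Proof.
exists time_series; split=> [//|j t jk _|j jk].
  exact: cvg_within_filter (time_series_cvg_slope (t := t) jk).
exact: continuous_subspaceT (continuous_time_series jk).
Qed.

End time_series.

(** * Shear fields *)

Section rv_norm.
Variables (R : realType) (d : nat).

Lemma rV_norm_ge (x : 'rV[R]_d) i : `|x ord0 i| <= `|x|.
Proof.
rewrite [leRHS](mx_normrE x : `|x| = _).
exact: (@le_bigmax _ _ _ 0 (fun ij : 'I_1 * 'I_d => `|x ij.1 ij.2|) (ord0, i)).
Qed.

Lemma rV_norm_le (x : 'rV[R]_d) M : 0 <= M -> (forall i, `|x ord0 i| <= M) ->
  `|x| <= M.
Proof.
move=> M0 xM; rewrite [leLHS](mx_normrE x : `|x| = _).
by apply: bigmax_le => // -[i j] _ /=; rewrite ord1.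
Qed.

End rv_norm.

Section shear.
Variables (R : realType) (d : nat) (a : R).

Definition shear_field (i j : 'I_d) (c : R -> R) (x : torus R d) : 'rV[R]_d :=
  circle_fun c (tnth x j) *: basis_vec R i.

Lemma shear_fieldE i j c x l :
  shear_field i j c x ord0 l = (l == i)%:R * circle_fun c (tnth x j).
Proof. by rewrite !mxE eqxx mulrC. Qed.

Variables (i j : 'I_d) (c : R -> R) (B H : R).
Hypothesis cP : forall x (k : int), c (x + k%:~R) = c x.
Hypothesis cB : forall x, `|c x| <= B.
Hypothesis cH : forall x y, `|c x - c y| <= H * `|x - y| `^ a.
Hypothesis a_ge0 : 0 <= a.

Let B0 : 0 <= B. Proof. exact: le_trans (cB 0). Qed.

Let H0 : 0 <= H.
Proof. by have := le_trans (normr_ge0 _) (cH 1 0); rewrite subr0 normr1 powR1 mulr1. Qed.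

Lemma shear_values_le x : holder_values (shear_field i j c) x <= B.
Proof.
apply: rV_norm_le => // l; rewrite shear_fieldE normrM.
apply: le_trans _ (cB (repr (tnth x j))); rewrite ler_piMl//.
by case: eqP; rewrite ?normr1 ?normr0.
Qed.

Lemma shear_quotients_le p : holder_quotients a (shear_field i j c) p <= H.
Proof.
rewrite /holder_quotients.
have h : `|shear_field i j c (torus_proj p.1) - shear_field i j c (torus_proj p.2)|
    <= H * `|p.1 - p.2| `^ a.
  apply: rV_norm_le; first by rewrite mulr_ge0// powR_ge0.
  move=> l; rewrite !mxE eqxx /= -mulrBl normrM.
  apply: le_trans (_ : `|circle_fun c (tnth (torus_proj p.1) j) -
    circle_fun c (tnth (torus_proj p.2) j)| <= _).
    by rewrite ler_piMr//; case: eqP; rewrite ?normr1 ?normr0.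
  rewrite !tnth_mktuple !circle_funE//; apply: le_trans (cH _ _) _.
  rewrite ler_wpM2l// ge0_ler_powR// ?nnegrE//.
  by have := rV_norm_ge (p.1 - p.2) j; rewrite !mxE.
have [->|p0] := eqVneq (`|p.1 - p.2| `^ a) 0; first by rewrite invr0 mulr0.
by rewrite ler_pdivrMr// lt0r p0 powR_ge0.
Qed.

Lemma shear_is_holder : shear_field i j c \in @is_holder R d a.
Proof.
apply/asboolP; split; [exists B|exists H] => _ [x _ <-].
  exact: shear_values_le.
exact: shear_quotients_le.
Qed.

Definition shear_map : holder_map d a := HolderMap shear_is_holder.

Lemma shear_map_norm : `|shear_map| <= B + H.
Proof.
rewrite [leLHS]/(holder_norm shear_map) /holder_norm; apply: lerD; apply: ge_sup.
- by exists (holder_values shear_map (torus_proj 0)), (torus_proj 0).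
- by move=> _ [x _ <-]; exact: shear_values_le.
- by exists (holder_quotients a shear_map (0, 0)), (0, 0).
- by move=> _ [x _ <-]; exact: shear_quotients_le.
Qed.

End shear.

Lemma holder_map_sumE (R : realType) (d : nat) (a : R) (I : Type) (r : seq I)
  (c : I -> R) (f : I -> holder_map d a) (x : torus R d) l :
  (\sum_(n <- r) c n *: f n) x ord0 l = \sum_(n <- r) c n * f n x ord0 l.
Proof.
elim: r => [|n r IH]; first by rewrite !big_nil mxE.
by rewrite !big_cons -IH !mxE.
Qed.

(** * Characteristics *)

Section completed_lebesgue.
Variable R : realType.
Local Notation cmu := (@completed_lebesgue_measure R).
Local Notation mu := (@lebesgue_measure R).
Local Notation cR := (caratheodory_type (@wlength R idfun)^*%mu).

Lemma borel_completed (A : set R) :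
  measurable (A : set (measurableTypeR R)) -> measurable (A : set cR).
Proof. exact: sub_caratheodory. Qed.

Lemma measurable_fun_completed (D : set R) (f : R -> R) :
  measurable (D : set (measurableTypeR R)) ->
  measurable_fun (D : set (measurableTypeR R)) f ->
  measurable_fun (D : set cR) f.
Proof.
by move=> mD mf mD' A mA; apply: borel_completed; exact: mf.
Qed.

(** Characteristics are integrated against the completed measure. The identity map pushes it forward
    to the Borel one, so integrals of continuous functions agree and the fundamental theorem of
    calculus applies. *)
Lemma completed_integral_itv (a b : R) (f : R -> R) : a <= b -> continuous f ->
  cmu.-integrable `]a, b]%classic (EFin \o f) /\
  \int[cmu]_(s in `]a, b]) f s = \int[mu]_(s in `[a, b]) f s.
Proof.
move=> ab cf.
have mf : measurable_fun setT f by exact: continuous_measurable_fun.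
have mI : measurable (`]a, b]%classic : set (measurableTypeR R)) by exact: measurable_itv.
have cfI : {within `[a, b]%classic, continuous f} by exact: continuous_subspaceT.
have cI := @segment_compact R a b.
have imu : mu.-integrable `]a, b]%classic (EFin \o f).
  apply: integrableS (continuous_compact_integrable cI cfI) => //.
  exact: subset_itv_oc_cc.
have bf : [bounded f x | x in `]a, b]%classic].
  have /compact_bounded[M [_ fM]] := continuous_compact cfI cI.
  exists M; split; rewrite ?num_real// => x Mx s sab; apply: fM => //=.
  by exists s => //; exact: subset_itv_oc_cc.
have intf : cmu.-integrable `]a, b]%classic (EFin \o f).
  apply: measurable_bounded_integrable => //.
  - exact: borel_completed.
  - have : (mu `]a, b]%classic < +oo)%E.
      by rewrite lebesgue_measure_itv/=; case: ifP; rewrite ?ltry.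
    by [].
  - by apply: measurable_fun_completed => //; exact: measurable_funTS.
split=> //; rewrite -Rintegral_itv_obnd_cbnd// /Rintegral; congr fine.
have mid : measurable_fun setT (fun x : cR => x : measurableTypeR R).
  by move=> _ A mA; rewrite setTI; exact: borel_completed.
have mEf : measurable_fun setT (EFin \o f : measurableTypeR R -> \bar R).
  exact/measurable_EFinP.
exact/esym/(@integral_pushforward _ _ _ _ _ _ mid cmu _ _ mEf intf mI).
Qed.

End completed_lebesgue.

(** * Time slots and the explicit form of characteristics *)

Section slots.
Variables (R : realType) (T : R) (k : nat).
Hypothesis T_gt0 : 0 < T.
Implicit Types (s t : R) (n m : nat).

Definition slot_time n : R := T / 2 ^+ n.

Lemma slot_time_gt0 n : 0 < slot_time n.
Proof. by rewrite divr_gt0// exprn_gt0. Qed.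

Lemma slot_timeS n : slot_time n = 2 * slot_time n.+1.
Proof. by rewrite /slot_time exprS; field; rewrite lt0r_neq0// exprn_gt0. Qed.

Lemma slot_time_lt n : slot_time n.+1 < slot_time n.
Proof. by rewrite (slot_timeS n); have := slot_time_gt0 n.+1; lra. Qed.

Lemma slot_time_le m n : (m <= n)%N -> slot_time n <= slot_time m.
Proof.
elim: n => [|n IH]; first by rewrite leqn0 => /eqP->.
rewrite leq_eqVlt => /orP[/eqP->//|/IH]; apply: le_trans.
exact: ltW (slot_time_lt n).
Qed.

Lemma slot_time0 : slot_time 0 = T.
Proof. by rewrite /slot_time expr0 divr1. Qed.

Lemma slot_time_leT n : slot_time n <= T.
Proof. by rewrite -slot_time0; exact: slot_time_le. Qed.

Lemma slot_scaleE n s : s * slot_scale T n = s / slot_time n.+1.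
Proof. by rewrite /slot_scale /slot_time invf_div. Qed.

Lemma time_coef_other m n s : m != n ->
  slot_time n.+1 <= s <= slot_time n -> time_coef T k 0 m s = 0.
Proof.
move=> mn /andP[h1 h2]; apply: time_coef_out; rewrite slot_scaleE.
have tm := slot_time_gt0 m.+1.
have [lt_mn|lt_nm] : (m < n \/ n < m)%N by apply/orP; rewrite -neq_ltn.
  by left; rewrite ler_pdivrMr// mul1r; apply: le_trans h2 (slot_time_le lt_mn).
right; rewrite ler_pdivlMr// -slot_timeS.
by apply: le_trans h1; exact: slot_time_le.
Qed.

(** An antiderivative is [ramp] composed with the affine map of the slot onto [0, 1]; it climbs from
    0 to 1. *)
Lemma integral_time_coef n :
  (@completed_lebesgue_measure R).-integrable `]slot_time n.+1, slot_time n]%classic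
    (EFin \o time_coef T k 0 n) /\
  \int[@completed_lebesgue_measure R]_(s in `]slot_time n.+1, slot_time n])
    time_coef T k 0 n s = 1.
Proof.
have cc : continuous (time_coef T k 0 n) by exact: continuous_time_coef.
have [h1 h2] := completed_integral_itv (ltW (slot_time_lt n)) cc.
split=> //; rewrite h2 /Rintegral.
pose c := slot_scale T n.
have c0 : 0 < c by exact: slot_scale_gt0.
pose g : R -> R := c \*: (@id R) - cst 1.
have gE s : g s = s * c - 1 by rewrite /g /= mulrC.
pose F : R -> R := horner (ramp R k) \o g.
have dF s : is_derive s 1 F ((ramp R k)^`().[g s] * c).
  have h : is_derive s 1 g c by apply: is_derive_eq; rewrite subr0 [_ *: _]mulr1.
  exact: (@is_derive1_comp R _ g s _ _ (is_derive_poly (ramp R k) (g s)) h).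
have cF : continuous F.
  move=> s; apply: differentiable_continuous; apply/derivable1_diffP.
  by have [] := dF s.
rewrite (continuous_FTC2 (slot_time_lt n) (F := F)).
- rewrite /F /= !gE /c !slot_scaleE divff ?lt0r_neq0 ?slot_time_gt0//.
  rewrite (slot_timeS n) -mulrA divff ?lt0r_neq0 ?slot_time_gt0//.
  rewrite subrr ramp0 (_ : 2 * 1 - 1 = 1) ?ramp1 ?subr0//; lra.
- exact: continuous_subspaceT.
- split.
  + by move=> s _; have [] := dF s.
  + by apply: cvg_at_right_filter; exact: cF.
  + by apply: cvg_at_left_filter; exact: cF.
- move=> s; rewrite in_itv/= => /andP[s1 s2].
  rewrite derive1E; have [_ ->] := dF s.
  rewrite /time_coef expr1 -/c /pulse cutoff_in.
  + by rewrite derivn1 -gE.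
  + by rewrite derivn_ramp_root//; left.
  + by rewrite derivn_ramp_root//; right.
  + have tau := slot_time_gt0 n.+1; have tauS := slot_timeS n.
    by rewrite /c slot_scaleE subr_ge0 lerBlDr ler_pdivlMr// ler_pdivrMr//; lra.
Qed.

End slots.

Section steps.
Variables (R : realType) (d : nat) (i0 i1 : 'I_d) (q : nat).
Hypothesis i01 : i0 != i1.
Implicit Types (n : nat) (y : torus R d).

Definition moving n : 'I_d := if odd n then i1 else i0.
Definition resting n : 'I_d := if odd n then i0 else i1.

Lemma movingS n : moving n.+1 = resting n.
Proof. by rewrite /moving /resting /=; case: odd. Qed.

Lemma restingS n : resting n.+1 = moving n.
Proof. by rewrite /moving /resting /=; case: odd. Qed.

Lemma resting_neq n : resting n != moving n.
Proof. by rewrite /moving /resting; case: odd; rewrite // eq_sym. Qed.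

(** Time is reversed: the field carries the opposite of the profile, so going from [slot_time n]
    back to [slot_time n.+1] adds the profile. *)
Definition step_back n y : torus R d :=
  [tuple tnth y l +
    circle_pi ((l == moving n)%:R * profile_circle q n (tnth y (resting n))) | l < d].

(** [iteri] applies step 0 first, so this leads from time T back to [slot_time n]. *)
Definition flow_back n y : torus R d := iteri n (fun m => step_back m) y.

End steps.

Lemma holder_entry_le (R : realType) (d : nat) (a : R) (f : holder_map d a) x i :
  `|f x ord0 i| <= `|f|.
Proof.
have /asboolP[h1 h2] := holder_funP f.
apply: le_trans (rV_norm_ge _ _) _.
rewrite [leRHS]/(holder_norm f) /holder_norm -[leLHS]addr0 lerD//.
  by apply: ub_le_sup => //; exists x.
apply: le_trans (_ : holder_quotients a f (0, 0) <= _).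
  by rewrite /holder_quotients subrr normr0 mul0r.
by apply: ub_le_sup => //; exists (0, 0).
Qed.

Section trajectories.
Variables (R : realType) (d : nat) (a T : R) (k q : nat) (i0 i1 : 'I_d).
Variables (v : nat -> holder_map d a) (C : R).
Hypothesis T_gt0 : 0 < T.
Hypothesis C_ge0 : 0 <= C.
Hypothesis i01 : i0 != i1.
Hypothesis v_le : forall n, `|v n| <= C * (2 ^+ (k + 4))^-1 ^+ n.
Hypothesis vE : forall n x l, v n x ord0 l =
  (l == moving i0 i1 n)%:R * - profile_circle q n (tnth x (resting i0 i1 n)).
Implicit Types (n : nat) (x : torus R d) (s t : R) (l : 'I_d).

Local Notation cmu := (@completed_lebesgue_measure R).
Local Notation u := (time_series T k v 0).

Lemma velocity_slot n s x l : slot_time T n.+1 <= s <= slot_time T n ->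
  u s x ord0 l = time_coef T k 0 n s *
    ((l == moving i0 i1 n)%:R * - profile_circle q n (tnth x (resting i0 i1 n))).
Proof.
move=> sn; pose N := maxn (slot_count T s) n.+1.
rewrite (@time_seriesE _ _ _ _ _ T_gt0 0 s N) ?leq_maxl//.
have nN : (n < N)%N by rewrite leq_maxr.
rewrite holder_map_sumE (bigD1 (Ordinal nN))//= big1 ?addr0 ?vE// => m mn.
by rewrite (time_coef_other k T_gt0 _ sn) ?mul0r.
Qed.

Lemma velocity_bounded : exists2 M, 0 <= M & forall s x l,
  s \in `[0, T] -> `|u s x ord0 l| <= M.
Proof.
have [K K0 hK] := time_series_small T_gt0 C_ge0 v_le.
exists (K * T ^+ 2); first by rewrite mulr_ge0// sqr_ge0.
move=> s x l; rewrite in_itv/= => /andP[s0 sT].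
apply: le_trans (holder_entry_le _ _ _) _; apply: le_trans (hK 0 s isT) _.
by rewrite ler_wpM2l// lerXn2r// nnegrE (le_trans s0).
Qed.

Variable X : R -> torus R d -> torus R d.

Definition characteristic x : Prop :=
  (forall i, cmu.-integrable `[0, T] (fun s => (u s (X s x) ord0 i)%:E)) /\
  forall t, t \in `[0, T] -> X t x = torus_shift x
    (\row_i \int[cmu]_(s in `[0, t]) u s (X s x) ord0 i).

Variable x : torus R d.
Hypothesis xP : characteristic x.

Let U l s := u s (X s x) ord0 l.

Let cm_itv (i : interval R) :
  measurable ([set` i] : set (caratheodory_type (@wlength R idfun)^*%mu)).
Proof. by apply: borel_completed; exact: measurable_itv. Qed.

Let intU l (i : interval R) : [set` i] `<=` `[0, T]%classic ->
  cmu.-integrable [set` i] (EFin \o U l).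
Proof. by move=> iT; apply: integrableS (xP.1 l). Qed.

Lemma characteristicE l t : t \in `[0, T] ->
  tnth (X t x) l = tnth x l + circle_pi (\int[cmu]_(s in `[0, t]) U l s).
Proof. by move=> tT; rewrite xP.2// tnth_mktuple mxE. Qed.

Lemma displacement_le (M : R) l t : 0 <= M -> (forall s y l, s \in `[0, T] -> `|u s y ord0 l| <= M) ->
  t \in `[0, T] -> `|\int[cmu]_(s in `[0, t]) U l s| <= M * t.
Proof.
move=> M0 uM; rewrite in_itv/= => /andP[t0 tT].
have sub : `[0, t]%classic `<=` `[0, T]%classic by exact: subset_itvl.
have I1 : cmu.-integrable `[0, t]%classic (EFin \o U l) by exact: intU.
apply: le_trans (le_normr_Rintegral (cm_itv `[0, t]) I1) _.
have e : cmu `[0, t]%classic = t%:E.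
  have : lebesgue_measure `[0, t]%classic = t%:E.
    by rewrite lebesgue_measure_itv/= lte_fin; case: ltP => [|h]; rewrite ?oppr0 ?adde0//; congr EFin; lra.
  by [].
have I2 : cmu.-integrable `[0, t]%classic (EFin \o cst M).
  apply: measurable_bounded_integrable => //.
    by rewrite [ltLHS]e ltry.
  by exists `|M|; split; rewrite ?num_real// => r Mr s _; exact: ltW.
have -> : M * t = \int[cmu]_(s in `[0, t]) cst M s.
  transitivity (M * fine (cmu `[0, t]%classic)); first by rewrite e.
  exact/esym/Rintegral_cst/cm_itv.
apply: (le_Rintegral (cm_itv `[0, t])) => //.
  exact: integrable_norm.
by move=> s st; apply: uM; exact: sub.
Qed.

Lemma characteristic0 : X 0 x = x.
Proof.
have [M M0 uM] := velocity_bounded.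
have z : (0 : R) \in `[0, T] by rewrite in_itv/= lexx ltW.
apply: eq_from_tnth => l; rewrite characteristicE//.
have := displacement_le l M0 uM z; rewrite mulr0 normr_le0 => /eqP->.
by rewrite circle_pi0 addr0.
Qed.

Let slot_in n t : slot_time T n.+1 <= t <= slot_time T n -> t \in `[0, T].
Proof.
move=> /andP[h1 h2]; rewrite in_itv/=; apply/andP; split.
  by apply: le_trans h1; exact/ltW/slot_time_gt0.
by apply: le_trans h2 _; exact: slot_time_leT.
Qed.

Lemma characteristic_slot n l t : slot_time T n.+1 <= t <= slot_time T n ->
  tnth (X t x) l = tnth (X (slot_time T n.+1) x) l +
    circle_pi (\int[cmu]_(s in `]slot_time T n.+1, t]) U l s).
Proof.
move=> tn; have tT := slot_in tn; have /andP[h1 h2] := tn.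
have nT : slot_time T n.+1 \in `[0, T].
  by apply: (@slot_in n); rewrite lexx ltW// slot_time_lt.
rewrite !characteristicE// -addrA -circle_piD; congr (_ + circle_pi _).
have n0 := ltW (slot_time_gt0 T_gt0 n.+1).
rewrite -Rintegral_setU; [|exact: cm_itv|exact: cm_itv| |].
- by rewrite -itv_bndbnd_setU// bnd_simp.
- rewrite -itv_bndbnd_setU ?bnd_simp//; apply: intU; apply: subset_itvl.
  by move: tT; rewrite in_itv/= bnd_simp => /andP[].
- rewrite disj_set2E; apply/eqP/seteqP; split => // s [/=].
  by rewrite !in_itv/= => /andP[_ s1] /andP[s2 _]; move: s2; rewrite ltNge s1.
Qed.

Lemma characteristic_resting n l t : slot_time T n.+1 <= t <= slot_time T n ->
  l != moving i0 i1 n -> tnth (X t x) l = tnth (X (slot_time T n.+1) x) l.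
Proof.
move=> tn ln; rewrite (characteristic_slot l tn).
rewrite (@eq_Rintegral _ _ _ cmu _ (cst 0)).
  by rewrite (Rintegral_cst _ (cm_itv `]_, t])) mul0r circle_pi0 addr0.
move=> s; rewrite inE/= in_itv/= => /andP[s1 s2]; rewrite /U (@velocity_slot n).
  by rewrite (negbTE ln) mul0r mulr0.
by have /andP[_ tn2] := tn; rewrite ltW//= (le_trans s2).
Qed.

(** During the slot the resting coordinate is constant, so the velocity of the moving one is a
    constant times [time_coef], whose integral is 1. *)
Lemma characteristic_step_back n :
  X (slot_time T n.+1) x = step_back i0 i1 q n (X (slot_time T n) x).
Proof.
have nn : slot_time T n.+1 <= slot_time T n <= slot_time T n.
  by rewrite lexx andbT ltW// slot_time_lt.
have rest := characteristic_resting nn (resting_neq i01 n).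
apply: eq_from_tnth => l; rewrite tnth_mktuple rest.
have [->|ln] := eqVneq l (moving i0 i1 n); last first.
  by rewrite mul0r circle_pi0 addr0 (characteristic_resting nn ln).
rewrite mul1r (characteristic_slot _ nn) -addrA -circle_piD.
set c := profile_circle _ _ _.
rewrite (@eq_Rintegral _ _ _ cmu _ (fun s => time_coef T k 0 n s * - c)).
  have [I1 I2] := integral_time_coef k T_gt0 n.
  rewrite (RintegralZr _ (cm_itv `]_, _]) I1) I2.
  by rewrite mul1r addNr circle_pi0 addr0.
move=> s; rewrite inE/= in_itv/= => /andP[s1 s2].
have sn : slot_time T n.+1 <= s <= slot_time T n by rewrite ltW.
rewrite /U (velocity_slot _ _ sn) eqxx mul1r; congr (_ * - profile_circle _ _ _).
exact: characteristic_resting sn (resting_neq i01 n).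
Qed.

Lemma characteristic_flow_back n :
  X (slot_time T n) x = flow_back i0 i1 q n (X T x).
Proof.
elim: n => [|n IH]; first by rewrite slot_time0.
by rewrite characteristic_step_back IH.
Qed.

End trajectories.

(** * Lebesgue measure on the torus *)

Section circle_measure_theory.
Variable R : realType.
Local Notation mu := (@lebesgue_measure R).
Local Notation mR := (measurableTypeR R).

Lemma measurable_frac : measurable_fun (setT : set mR) (fun x : R => x - (Num.floor x)%:~R).
Proof.
apply: measurable_funB => //; apply: nondecreasing_measurable => //.
by move=> x y xy; rewrite ler_int le_floor.
Qed.

(* [repr] picks arbitrary representatives; these ones depend measurably on the point. *)
Definition circle_rep : circle R -> R := circle_fun (fun x => x - (Num.floor x)%:~R).

Lemma circle_repK z : circle_pi (circle_rep z) = z.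
Proof.
rewrite /circle_rep /circle_fun -[RHS]circle_reprK.
by apply/circle_piP; rewrite addrAC subrr add0r rpredN intr_int.
Qed.

Lemma measurable_circle_rep : measurable_fun setT circle_rep.
Proof.
apply: measurable_circle_fun; last exact: measurable_frac.
by move=> x k; rewrite floorDrz ?intr_int// intrKfloor intrD; lra.
Qed.

Lemma measurable_translate (r : R) : measurable_fun (setT : set mR) (fun x : R => x + r).
Proof. exact: measurable_funD. Qed.

Lemma measurable_circle_add d (W : measurableType d) (z : W -> circle R) (f : W -> R) :
  measurable_fun setT z -> measurable_fun setT f ->
  measurable_fun setT (fun w => z w + circle_pi (f w)).
Proof.
move=> mz mf.
rewrite (_ : (fun w => _) = @circle_pi R \o (fun w => circle_rep (z w) + f w)).
  apply: measurableT_comp; first exact: measurable_circle_pi.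
  by apply: measurable_funD => //; exact: measurableT_comp measurable_circle_rep mz.
by apply/funext => w /=; rewrite circle_piD circle_repK.
Qed.

Lemma lebesgue_translate (r : R) (A : set mR) : measurable A ->
  mu ((fun x => x + r) @^-1` A) = mu A.
Proof.
move=> mA; pose tr : mR -> mR := fun x => x + r.
have mtr : measurable_fun setT tr by exact: measurable_translate.
pose trm : {mfun mR >-> mR} := HB.pack tr (isMeasurableFun.Build _ _ _ _ _ mtr).
apply/esym; apply: (@lebesgue_measure_unique R (pushforward mu trm)) => //.
move=> _ [[a b] _ <-] /=; rewrite /pushforward.
have -> : trm @^-1` `]a, b] = `]a - r, b - r]%classic.
  by apply/seteqP; split => s /=; rewrite !in_itv/= /tr ltrBlDr lerBrDr.
rewrite !lebesgue_measure_itv/= !lte_fin ltrD2r; case: ifP => // _.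
by rewrite -!EFinB; congr EFin; lra.
Qed.

Lemma circle_measure_translate (r : R) (A : set (circle R)) : measurable A ->
  circle_measure ((fun z => z + circle_pi r) @^-1` A) = circle_measure A.
Proof.
move=> mA.
wlog : r / 0 <= r < 1.
  move=> H; have := H (r - (Num.floor r)%:~R).
  have -> : circle_pi (r - (Num.floor r)%:~R) = circle_pi r.
    by apply/circle_piP; rewrite addrAC subrr add0r rpredN intr_int.
  apply; have /andP[] := floor_itv r; rewrite intrD => ? ?.
  by rewrite subr_ge0 ltrBlDl; apply/andP; split.
move=> /andP[r0 r1]; rewrite /circle_measure /pushforward /mrestr.
set P : set mR := circle_pi (R:=R) @^-1` A.
have mP : measurable P by exact: mA.
have P1 x : P (x + 1) = P x.
  by rewrite /P/preimage /= circle_piDint// -[1]/(1%:~R) intr_int.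
have -> : circle_pi (R:=R) @^-1` ((fun z => z + circle_pi r) @^-1` A) `&` `[0, 1[ =
    (fun x => x + r) @^-1` (P `&` `[r, r + 1[).
  apply/seteqP; split => x /=; rewrite !in_itv/= /P /= circle_piD => -[Ax] /andP[x0 x1];
    by split=> //; apply/andP; split; lra.
rewrite lebesgue_translate; last by apply: measurableI => //; exact: measurable_itv.
have itvU (a b c : R) : a <= b -> b <= c -> P `&` `[a, c[ = (P `&` `[a, b[) `|` (P `&` `[b, c[).
  move=> ab bc; rewrite -setIUr -itv_bndbnd_setU// ?bnd_simp//.
have muU (a b c : R) : a <= b -> b <= c ->
    mu (P `&` `[a, c[) = (mu (P `&` `[a, b[) + mu (P `&` `[b, c[))%E.
  move=> ab bc; rewrite (itvU _ _ _ ab bc) measureU//.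
  - by apply: measurableI => //; exact: measurable_itv.
  - by apply: measurableI => //; exact: measurable_itv.
  - apply/seteqP; split=> // x [[_ /=] + [_ /=]]; rewrite !in_itv/=.
    by move=> /andP[_ xb] /andP[bx _]; move: xb; rewrite ltNge bx.
(* The windows [0, 1[ and [r, r + 1[ share [r, 1[. The leftovers [0, r[ and [1, r + 1[ differ by a
   unit translation, under which P is invariant. *)
rewrite (muU r 1 (r + 1)) ?(ltW r1) ?lerDr// (muU 0 r 1) ?(ltW r1)// addeC.
congr (_ + _)%E.
rewrite -[LHS](@lebesgue_translate 1); last by apply: measurableI => //; exact: measurable_itv.
congr mu; apply/seteqP; split => x /=; rewrite P1 !in_itv/= => -[Px] /andP[x0 x1];
  by split=> //; apply/andP; split; lra.
Qed.

End circle_measure_theory.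

Section torus_measure_theory.
Variable R : realType.

Lemma torus_marginal (d : nat) (i : 'I_d) (C : set (circle R)) : measurable C ->
  torus_measure R d [set x | C (tnth x i)] = circle_measure C.
Proof.
move=> mC; elim: d i => [[]//|d IH] i.
rewrite /= /distribution /pushforward.
have mS j : measurable [set x : torus R d | C (tnth x j)].
  by rewrite -[X in measurable X]setTI; exact: measurable_tnth.
have [j ->|->] := unliftP ord0 i.
  have -> : @torus_cons R d @^-1` [set x | C (tnth x (lift ord0 j))] =
      setT `*` [set x | C (tnth x j)].
    by apply/seteqP; split => -[z y] /=; rewrite tnthS => // -[].
  transitivity (circle_measure [set: circle R] *
    torus_measure R d [set x | C (tnth x j)])%E; first exact: product_measure1E.
  by rewrite (@probability_setT _ _ _ (@circle_measure R)) mul1e IH.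
have -> : @torus_cons R d @^-1` [set x | C (tnth x ord0)] = C `*` setT.
  by apply/seteqP; split => -[z y] //= -[].
transitivity (circle_measure C * torus_measure R d setT)%E; first exact: product_measure1E.
by rewrite probability_setT mule1.
Qed.

Lemma measurable_torus_shift (d : nat) (v : 'rV[R]_d) :
  measurable_fun setT (fun x : torus R d => torus_shift x v).
Proof.
apply/measurable_fun_tnthP => i.
rewrite (_ : _ \o _ = fun x : torus R d => tnth x i + circle_pi (v ord0 i)).
  by apply: measurable_circle_add; [exact: measurable_tnth|exact: measurable_cst].
by apply/funext => x /=; rewrite tnth_mktuple.
Qed.

(** Induction on d: the shift acts factor by factor, so its pushforward agrees with the product
    measure on rectangles. *)
Lemma torus_measure_shift (d : nat) (v : 'rV[R]_d) (A : set (torus R d)) : measurable A ->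
  torus_measure R d ((fun x => torus_shift x v) @^-1` A) = torus_measure R d A.
Proof.
elim: d v A => [|d IH] v A mA.
  by congr (torus_measure R 0 _); apply/seteqP; split => x /=;
    rewrite !(tuple0 x) (tuple0 (torus_shift _ _)).
pose w : 'rV[R]_d := \row_j v ord0 (lift ord0 j).
pose f (x : circle R * torus R d) := (x.1 + circle_pi (v ord0 ord0), torus_shift x.2 w).
have mf : measurable_fun setT f.
  apply/measurable_fun_pairP; split.
    by apply: measurable_circle_add => //; exact: measurable_cst.
  by apply: (measurableT_comp (measurable_torus_shift w)).
pose fm : {mfun _ >-> _} := HB.pack f (isMeasurableFun.Build _ _ _ _ _ mf).
have E x : torus_shift (torus_cons x) v = torus_cons (f x).
  case: x => z y; apply: eq_from_tnth => i; rewrite tnth_mktuple.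
  have [j ->|->] := unliftP ord0 i; last by [].
  by rewrite !tnthS tnth_mktuple mxE.
rewrite /= /distribution /pushforward.
have mA' : measurable (@torus_cons R d @^-1` A).
  by rewrite -[X in measurable X]setTI; exact: measurable_torus_cons.
rewrite [RHS](@product_measure_unique _ _ _ _ _ (@circle_measure R) (torus_measure R d)
  (pushforward (@circle_measure R \x torus_measure R d)%E fm))//.
  rewrite /pushforward; congr ((_ \x _)%E _).
  by apply/seteqP; split => x /=; rewrite E.
move=> B D mB mD; rewrite /pushforward.
have mB' : measurable ((fun z => z + circle_pi (v ord0 ord0)) @^-1` B).
  by rewrite -[X in measurable X]setTI; apply: measurable_circle_add => //; exact: measurable_cst.
have mD' : measurable ((fun y => torus_shift y w) @^-1` D).
  by rewrite -[X in measurable X]setTI; exact: measurable_torus_shift.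
apply: eq_trans (product_measure1E _ _ mB' mD') _.
by congr (_ * _)%E; [exact: circle_measure_translate|exact: IH].
Qed.

End torus_measure_theory.

(** * The limit of the backward flow *)

(** Terms of the sequence differ by integers, and terms near the limit by less than 1, so the
    sequence is eventually constant. This allows limits to be taken on real displacements and then
    projected to the circle. *)
Lemma circle_pi_lim (R : realType) (r : nat -> R) (l : R) (c : circle R) :
  r @ \oo --> l -> (forall n, circle_pi (r n) = c) -> circle_pi l = c.
Proof.
move=> rl rc.
have /cvgrPdist_lt /(_ (2^-1)) := rl; rewrite invr_gt0 ltr0n => /(_ isT) [N _ rN].
rewrite -(rc N); congr circle_pi; apply: (cvg_unique _ rl) => //.
apply: cvg_near_cst; near=> n.
have h1 := rN N (leqnn N).
have h2 : `|l - r n| < 2^-1 by apply: rN; near: n; exact: nbhs_infty_ge.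
have : circle_pi (r n) = circle_pi (r N) by rewrite !rc.
move=> /circle_piP/intrP[m rm].
have m1 : `|r n - r N| < 1.
  rewrite (_ : r n - r N = (l - r N) - (l - r n)); last by lra.
  by apply: le_lt_trans (ler_normB _ _) _; move: h1 h2 => /=; lra.
have m0 : m = 0.
  by move: m1; rewrite rm -intr_norm -[1]/(1%:~R) ltr_int; case: (m) => [[|]|].
by move: rm; rewrite m0 => /eqP; rewrite subr_eq0 => /eqP.
Unshelve. all: by end_near. Qed.

Section flow_back_theory.
Variables (R : realType) (d : nat) (i0 i1 : 'I_d) (q : nat).
Hypothesis i01 : i0 != i1.
Hypothesis q_odd : odd q.
Variables (P rho : R).
Hypothesis P_ge0 : 0 <= P.
Hypothesis rho_ge0 : 0 <= rho.
Hypothesis rho_lt1 : rho < 1.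
Hypothesis profile_le : forall n x, `|profile q n x : R| <= P * rho ^+ n.
Implicit Types (n : nat) (y : torus R d) (l : 'I_d).

Local Notation moving := (moving i0 i1).
Local Notation resting := (resting i0 i1).
Local Notation step_back := (@step_back R d i0 i1 q).
Local Notation flow_back := (@flow_back R d i0 i1 q).

Lemma measurable_step_back n : measurable_fun setT (step_back n).
Proof.
apply/measurable_fun_tnthP => l.
rewrite (_ : _ \o _ = fun y : torus R d => tnth y l +
    circle_pi ((l == moving n)%:R * profile_circle q n (tnth y (resting n)))).
  apply: measurable_circle_add; first exact: measurable_tnth.
  apply: measurable_funM => //.
  exact: (measurableT_comp (@measurable_profile_circle R q q_odd n) (measurable_tnth _)).
by apply/funext => x /=; rewrite tnth_mktuple.
Qed.

Lemma measurable_flow_back n : measurable_fun setT (flow_back n).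
Proof.
elim: n => [|n IH]; first exact: measurable_id.
exact: measurableT_comp (measurable_step_back n) IH.
Qed.

Definition increment n y l : R :=
  (l == moving n)%:R * profile_circle q n (tnth (flow_back n y) (resting n)).

Definition displacement y l : R := limn (series (fun n => increment n y l)).

Lemma flow_backE n y l :
  tnth (flow_back n y) l = tnth y l + circle_pi (series (fun m => increment m y l) n).
Proof.
elim: n => [|n IH].
  by rewrite /series /= big_geq// circle_pi0 addr0.
rewrite seriesSr circle_piD addrA -IH.
by rewrite [LHS]tnth_mktuple.
Qed.

Lemma increment_le n y l : `|increment n y l| <= P * rho ^+ n.
Proof.
rewrite /increment normrM.
apply: le_trans _ (profile_le n (repr (tnth (flow_back n y) (resting n)))).
by rewrite ler_piMl//; case: eqP; rewrite ?normr1 ?normr0.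
Qed.

Lemma cvg_displacement y l :
  series (fun n => increment n y l) @ \oo --> displacement y l.
Proof.
apply: normed_cvg.
apply: (@series_le_cvg _ _ (geometric P rho)).
- by move=> n /=.
- by move=> n; rewrite /geometric/= mulr_ge0// exprn_ge0.
- by move=> n; exact: increment_le.
- by apply: is_cvg_geometric_series; rewrite ger0_norm.
Qed.

(** The limit pi of the backward flow: the real displacements are summed first and projected
    afterwards. *)
Definition fold_map y : torus R d :=
  [tuple tnth y l + circle_pi (displacement y l) | l < d].

Lemma measurable_fold_map : measurable_fun setT fold_map.
Proof.
apply/measurable_fun_tnthP => l.
rewrite (_ : _ \o _ = fun y : torus R d => tnth y l + circle_pi (displacement y l)).
  apply: measurable_circle_add; first exact: measurable_tnth.
  apply: (@measurable_fun_cvg _ _ _ _ (fun n y => series (fun m => increment m y l) n)).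
    move=> n; rewrite /series /=; apply: measurable_sum => m.
    apply: measurable_funM => //.
    apply: (measurableT_comp (@measurable_profile_circle R q q_odd m)).
    exact: (measurableT_comp (measurable_tnth _) (measurable_flow_back m)).
  by move=> y _; exact: cvg_displacement.
by apply/funext => x /=; rewrite tnth_mktuple.
Qed.

(** The sign conditions that [pair_step] requires at step n, meant to be read at the point
    [flow_back n y]. *)
Definition generic_at n y : Prop :=
  [/\ `|parity_circle q n (tnth y (resting n))| = 1,
      `|parity_circle q n.+2 (tnth y (resting n))| = 1 &
      `|parity_circle q n.+1 (tnth y (moving n))| = 1].

(** [i1] is the coordinate at rest in step 0, and 1/2 is [cell 0]: a point and its half turn form
    the initial pair for [pair_step]. *)
Definition half_turn y : torus R d :=
  torus_shift y (2^-1 *: basis_vec R i1).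

Lemma half_turnE y l :
  tnth (half_turn y) l = tnth y l + circle_pi ((l == i1)%:R * 2^-1).
Proof. by rewrite tnth_mktuple !mxE eqxx mulrC. Qed.

Lemma flow_back_pair y n : (forall m, (m < n)%N -> generic_at m (flow_back m y)) ->
  `|parity_circle q 1 (tnth y i0)| = 1 ->
  let z := flow_back n y in let z' := flow_back n (half_turn y) in
  [/\ tnth z' (moving n) = tnth z (moving n) +
        circle_pi (parity_circle q n (tnth z (resting n)) * cell_pred R q n),
      tnth z' (resting n) = tnth z (resting n) +
        circle_pi (- parity_circle q n.+1 (tnth z (moving n)) * cell R q n) &
      forall l, l != i0 -> l != i1 -> tnth z' l = tnth z l].
Proof.
move=> gen y1 /=; elim: n gen => [|n IH] gen.
  rewrite /= half_turnE (negbTE i01) mul0r mulr0; split=> //.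
  (* The shifts by 1/2 and by -1/2 coincide modulo 1, so either sign of the parity fits. *)
  - rewrite half_turnE eqxx mul1r; congr (_ + _); apply/circle_piP.
    rewrite /cell expr0 mulr1; have [->|->] := norm1P y1; apply/intrP.
      by exists 1; rewrite mulr1z; field.
    by exists 0; rewrite mulr0z; field.
  - by move=> l _ l1; rewrite half_turnE (negbTE l1) mul0r circle_pi0 addr0.
have [m m' ot] := IH (fun m mn => gen m (ltnW mn)).
have [g1 g2 g3] := gen n (ltnSn n).
have [s1 s2] := pair_step q_odd g1 g2 g3 m m'.
have rn := resting_neq i01 n.
have E z : tnth (step_back n z) (moving n) = tnth z (moving n) +
    circle_pi (profile_circle q n (tnth z (resting n))).
  by rewrite tnth_mktuple eqxx mul1r.
have E' z l : l != moving n -> tnth (step_back n z) l = tnth z l.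
  by move=> ln; rewrite tnth_mktuple (negbTE ln) mul0r circle_pi0 addr0.
rewrite movingS restingS /= -!/(flow_back n _) !E !(E' _ _ rn); split.
- exact: s1.
- exact: s2.
- move=> l l0 l1; rewrite !E' ?ot//.
    by rewrite /moving; case: odd.
  by rewrite /moving; case: odd.
Qed.

End flow_back_theory.

Lemma circle_piN (R : realType) (x : R) : circle_pi (- x) = - circle_pi x.
Proof. by apply: (addIr (circle_pi x)); rewrite -circle_piD !addNr circle_pi0. Qed.

Lemma circle_piB (R : realType) (x y : R) :
  circle_pi (x - y) = circle_pi x - circle_pi y.
Proof. by rewrite circle_piD circle_piN. Qed.

Lemma subr_eq_of_add (V : zmodType) (b c e v w : V) :
  b + v = c + w + e -> v - w - e = c - b.
Proof.
move=> E; apply/eqP; rewrite !subr_eq -(inj_eq (addrI b)) E.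
by rewrite !addrA [b + c]addrC addrK addrAC.
Qed.

(** * Merging of half turns in the limit *)

Section merging.
Variables (R : realType) (d : nat) (i0 i1 : 'I_d) (q : nat).
Hypothesis i01 : i0 != i1.
Hypothesis q_odd : odd q.
Hypothesis q_gt1 : (1 < q)%N.
Variables (P rho : R).
Hypothesis P_ge0 : 0 <= P.
Hypothesis rho_ge0 : 0 <= rho.
Hypothesis rho_lt1 : rho < 1.
Hypothesis profile_le : forall n x, `|profile q n x : R| <= P * rho ^+ n.
Implicit Types (n : nat) (y : torus R d) (l : 'I_d).

Local Notation moving := (moving i0 i1).
Local Notation resting := (resting i0 i1).
Local Notation flow_back := (@flow_back R d i0 i1 q).
Local Notation fold_map := (@fold_map R d i0 i1 q).
Local Notation generic_at := (@generic_at R d i0 i1 q).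

Lemma cvg_cell : cell R q @ \oo --> (0 : R).
Proof.
have -> : cell R q = geometric 2^-1 q%:R^-1.
  by apply/funext => n; rewrite /cell /geometric/= invfM exprVn.
apply: cvg_geometric; rewrite ger0_norm ?invr_ge0//.
by rewrite invf_lt1 ?ltr0n ?ltr1n// ltnW.
Qed.

(** By [flow_back_pair] the two backward orbits are within q * [cell n] of each other in every
    coordinate. This tends to 0, so in the limit the displacements compensate the initial half
    turn. *)
Lemma fold_half_turn y : (forall n, generic_at n (flow_back n y)) ->
  fold_map (half_turn i1 y) = fold_map y.
Proof.
move=> gen; have [_ _ y1] := gen 0%N.
apply: eq_from_tnth => l; rewrite [LHS]tnth_mktuple [RHS]tnth_mktuple.
have [e eE e_le] : exists2 e : nat -> R,
    (forall n, tnth (flow_back n (half_turn i1 y)) l = tnth (flow_back n y) l + circle_pi (e n)) &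
    (forall n, `|e n| <= q%:R * cell R q n).
  have H n : exists r : R, tnth (flow_back n (half_turn i1 y)) l = tnth (flow_back n y) l + circle_pi r
      /\ `|r| <= q%:R * cell R q n.
    have [m1 m2 m3] := flow_back_pair i01 q_odd (fun m _ => gen m) y1 (n := n).
    have c0 := cell_gt0 R q_odd n.
    have cc : cell R q n <= q%:R * cell R q n.
      by apply: ler_peMl; rewrite ?ler1n ?(ltnW q_gt1)// ltW.
    have [->|lm] := eqVneq l (moving n).
      exists (parity_circle q n (tnth (flow_back n y) (resting n)) * cell_pred R q n).
      split; first exact: m1.
      rewrite normrM; apply: le_trans (_ : 1 * cell_pred R q n <= _).
        by rewrite ler_pM ?parity_circle_le1// ger0_norm// cell_pred_ge0.
      by rewrite mul1r cell_pred_le.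
    have [->|lr] := eqVneq l (resting n).
      exists (- parity_circle q n.+1 (tnth (flow_back n y) (moving n)) * cell R q n).
      split; first exact: m2.
      rewrite normrM normrN; apply: le_trans cc; rewrite -[leRHS]mul1r.
      by rewrite ler_pM ?parity_circle_le1// gtr0_norm.
    exists 0; rewrite circle_pi0 addr0 normr0 mulr_ge0 ?(ltW c0)//; split=> //.
    by apply: m3; move: lm lr; rewrite /moving /resting; case: odd.
  have [e eP] := choice H; exists e => n; by have [] := eP n.
have e0 : e @ \oo --> (0 : R).
  apply/cvgr0Pnorm_le => eps eps0.
  have c0 : (fun n => q%:R * cell R q n) @ \oo --> (0 : R).
    by rewrite -[X in _ --> X](mulr0 q%:R); apply: cvgM; [exact: cvg_cst|exact: cvg_cell].
  move/cvgr0Pnorm_le : c0 => /(_ _ eps0); apply: filterS => n.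
  by apply: le_trans; apply: le_trans (e_le n) _; exact: ler_norm.
pose V (z : torus R d) := series (fun n => increment i0 i1 q n z l).
have cV (z : torus R d) : V z @ \oo --> displacement i0 i1 q z l.
  by apply: cvg_displacement profile_le _ _.
have key : circle_pi (displacement i0 i1 q (half_turn i1 y) l - displacement i0 i1 q y l - 0) =
    tnth y l - tnth (half_turn i1 y) l.
  apply: (@circle_pi_lim R (fun n => V (half_turn i1 y) n - V y n - e n)).
    by apply: cvgB => //; apply: cvgB; exact: cV.
  move=> n; have := eE n; rewrite !flow_backE -/(V _ n) -/(V _ n) => E.
  by rewrite !circle_piB; exact: subr_eq_of_add.
have := key; rewrite subr0 circle_piB => /eqP; rewrite subr_eq => /eqP ->.
by rewrite addrA [_ + (_ - _)]addrC subrK.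
Qed.

End merging.

(** * Nonexistence of a measure-preserving selection *)

(** The outer measure is an infimum over countable measurable covers. The preimage of a Borel set
    under X_T is only Lebesgue measurable; a Borel set containing it has a measurable preimage under
    [fold_map]. *)
Lemma mu_ext_borel_cover (R : realType) d (W : measurableType d)
    (mu : {measure set W -> \bar R}) (E : set W) (e : R) :
  (mu^* E < +oo)%mu%E -> 0 < e ->
  exists B : set W, [/\ measurable B, E `<=` B & (mu B <= mu^*%mu E + e%:E)%E].
Proof.
move=> Eoo e0.
have Efin : (mu^*)%mu E \is a fin_num by rewrite ge0_fin_numE// mu_ext_ge0.
have [_ [F [mF EF] <-] Fe] := lb_ereal_inf_adherent e0 Efin.
exists (\bigcup_n F n); split => //.
  by apply: bigcupT_measurable => n; exact: mF.
apply: le_trans (ltW Fe).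
apply: measure_sigma_subadditive => //.
by apply: bigcupT_measurable => n; exact: mF.
Qed.

Section no_selection.
Variables (R : realType) (d : nat) (a T : R) (k q : nat) (i0 i1 : 'I_d).
Variables (v : nat -> holder_map d a) (C : R).
Hypothesis T_gt0 : 0 < T.
Hypothesis C_ge0 : 0 <= C.
Hypothesis i01 : i0 != i1.
Hypothesis v_le : forall n, `|v n| <= C * (2 ^+ (k + 4))^-1 ^+ n.
Hypothesis vE : forall n x l, v n x ord0 l =
  (l == moving i0 i1 n)%:R * - profile_circle q n (tnth x (resting i0 i1 n)).
Hypothesis q_odd : odd q.
Hypothesis q_gt1 : (1 < q)%N.
Variables (P rho : R).
Hypothesis P_ge0 : 0 <= P.
Hypothesis rho_ge0 : 0 <= rho.
Hypothesis rho_lt1 : rho < 1.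
Hypothesis profile_le : forall n x, `|profile q n x : R| <= P * rho ^+ n.
Variable X : R -> torus R d -> torus R d.
Hypothesis sel : measure_preserving_selection T (time_series T k v 0) X.

Implicit Types (n : nat) (y x : torus R d) (l : 'I_d) (s t : R).

Local Notation mu := (torus_measure R d).
Local Notation moving := (moving i0 i1).
Local Notation resting := (resting i0 i1).
Local Notation flow_back := (@flow_back R d i0 i1 q).
Local Notation fold_map := (@fold_map R d i0 i1 q).
Local Notation generic_at := (@generic_at R d i0 i1 q).
Local Notation good := (characteristic T k v X).

(** Both measures are outer measures of preimages under X, at times s and t, and these preimages are
    nested up to the null set where the characteristic equation fails. It serves for [flow_back],
    for [fold_map] and for null sets alike. *)
Lemma transport s t (A B : set (torus R d)) : s \in `[0, T] -> t \in `[0, T] ->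
  measurable A -> measurable B ->
  (forall x, good x -> A (X s x) -> B (X t x)) -> (mu A <= mu B)%E.
Proof.
move=> sT tT mA mB AB.
have [N [mN N0 goodN]] := selection_characteristic sel.
rewrite -(selection_pushforward sel sT mA) -(selection_pushforward sel tT mB).
rewrite /pushforward -[lebesgue_torus _]/((mu^*)%mu _) -[lebesgue_torus (X t @^-1` B)]/((mu^*)%mu _).
apply: le_trans (_ : (mu^*)%mu (X t @^-1` B `|` N) <= _)%E.
  apply: le_mu_ext => x Ax; have [gx|ngx] := pselect (good x).
    by left; exact: AB.
  by right; exact: goodN.
apply: le_trans (outer_measureU2 _ _ _) _.
have N0' : ((mu^*)%mu N <= 0)%E.
  by rewrite (eq_trans (measurable_mu_extE mu mN) N0).
by rewrite -[leRHS]adde0; apply: leeD.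
Qed.

Let zeroT : 0 \in `[0, T]. Proof. by rewrite in_itv/= lexx ltW. Qed.
Let TT : T \in `[0, T]. Proof. by rewrite in_itv/= lexx ltW. Qed.

Let slotT n : slot_time T n \in `[0, T].
Proof. by rewrite in_itv/= ltW ?slot_time_gt0//= slot_time_leT. Qed.

(** X at [slot_time n] is both [flow_back n] of X_T x and x plus an integral over [0,
    [slot_time n]], which tends to 0 because the velocity is bounded. *)
Lemma fold_map_selection x : good x -> fold_map (X T x) = x.
Proof.
move=> gx; apply: eq_from_tnth => l; rewrite [LHS]tnth_mktuple.
have [M M0 uM] := velocity_bounded T_gt0 C_ge0 v_le.
pose W n := \int[@completed_lebesgue_measure R]_(s in `[0, slot_time T n])
  time_series T k v 0 s (X s x) ord0 l.
have W0 : W @ \oo --> (0 : R).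
  have tau0 : (fun n => M * slot_time T n) @ \oo --> (0 : R).
    rewrite -[X in _ --> X](mulr0 M); apply: cvgM; first exact: cvg_cst.
    have -> : slot_time T = geometric T 2^-1.
      by apply/funext => n; rewrite /slot_time /geometric /= exprVn.
    by apply: cvg_geometric; rewrite ger0_norm ?invr_ge0// invf_lt1// ltr1n.
  apply/cvgr0Pnorm_le => eps eps0.
  move/cvgr0Pnorm_le : tau0 => /(_ _ eps0); apply: filterS => n.
  apply: le_trans; apply: le_trans (displacement_le gx l M0 uM (slotT n)) _.
  exact: ler_norm.
pose V := series (fun n => increment i0 i1 q n (X T x) l).
have cV : V @ \oo --> displacement i0 i1 q (X T x) l.
  by apply: cvg_displacement profile_le _ _.
have key : circle_pi (displacement i0 i1 q (X T x) l - 0) = tnth x l - tnth (X T x) l.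
  apply: (@circle_pi_lim R (fun n => V n - W n)); first exact: cvgB.
  move=> n; rewrite circle_piB; apply/eqP; rewrite subr_eq -addrA [- _ + _]addrC addrA.
  rewrite eq_sym subr_eq addrC [X in _ == X]addrC -flow_backE.
  rewrite -(characteristic_flow_back T_gt0 i01 vE gx) addrC.
  by rewrite (characteristicE gx _ (slotT n)).
by have := key; rewrite subr0 => ->; rewrite addrC subrK.
Qed.

Let mfun_preim (f : torus R d -> torus R d) A : measurable_fun setT f ->
  measurable A -> measurable (f @^-1` A).
Proof. by move=> mf mA; rewrite -[X in measurable X]setTI; exact: mf. Qed.

(** Read off from the selection: [flow_back n] sends X_T x to X at [slot_time n] for almost every x,
    and X preserves the measure at both times. *)
Lemma flow_back_measure n A : measurable A -> (mu (flow_back n @^-1` A) <= mu A)%E.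
Proof.
move=> mA; apply: (transport TT (slotT n)) => //.
  exact: mfun_preim (measurable_flow_back _ _ q_odd _) mA.
by move=> x gx; rewrite /= -(characteristic_flow_back T_gt0 i01 vE gx).
Qed.

Definition transition_set n l : set (torus R d) := [set y | transition q n (tnth y l)].

Lemma transition_set_measure n l : (mu (transition_set n l) <= (margin R n)%:E)%E.
Proof.
rewrite torus_marginal; last exact: measurable_transition.
exact: transition_measure.
Qed.

Lemma measurable_transition_set n l : measurable (transition_set n l).
Proof.
rewrite -[X in measurable X]setTI; apply: measurable_tnth => //.
exact: measurable_transition.
Qed.

Definition bad_at n : set (torus R d) := flow_back n @^-1`
  (transition_set n (resting n) `|` transition_set n.+2 (resting n)
   `|` transition_set n.+1 (moving n)).

Lemma measurable_bad_at n : measurable (bad_at n).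
Proof.
apply: mfun_preim; first exact: measurable_flow_back.
by apply: measurableU; [apply: measurableU|]; exact: measurable_transition_set.
Qed.

Lemma bad_at_measure n : (mu (bad_at n) <= (3 * margin R n)%:E)%E.
Proof.
have mt := measurable_transition_set.
apply: le_trans (flow_back_measure _ _) _.
  by apply: measurableU; [apply: measurableU|]; exact: mt.
have mle m : (n <= m)%N -> margin R m <= margin R n.
  move=> nm; rewrite /margin lef_pV2 ?posrE ?exprn_gt0//.
  by rewrite ler_weXn2l ?ler1n// leq_add2r.
apply: le_trans (measureU2 _ _ _) _; [exact: measurableU|exact: mt|].
apply: le_trans (leeD (measureU2 _ (mt _ _) (mt _ _)) (lexx _)) _.
apply: le_trans (leeD (leeD (transition_set_measure _ _) (transition_set_measure _ _))
  (transition_set_measure _ _)) _.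
have := mle n.+1 (leqnSn n); have := mle n.+2 (leq_trans (leqnSn n) (leqnSn n.+1)).
by rewrite -!EFinD lee_fin; lra.
Qed.

Definition bad : set (torus R d) := \bigcup_n bad_at n.

Lemma bad_measure : (mu bad <= (8^-1 : R)%:E)%E.
Proof.
apply: le_trans (measure_sigma_subadditive _ measurable_bad_at _ (@subset_refl _ _)) _.
  by apply: bigcupT_measurable; exact: measurable_bad_at.
apply: lime_le; first by apply: is_cvg_nneseries.
apply: nearW => N.
apply: le_trans (_ : \sum_(0 <= n < N) (3 * margin R n)%:E <= _)%E.
  by apply: lee_sum => n _; exact: bad_at_measure.
rewrite sumEFin lee_fin.
(* Telescoping, since [margin] is halved at each step. *)
have -> : \sum_(0 <= n < N) 3 * margin R n = 6 * margin R 0 - 6 * margin R N.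
  elim: N => [|N IH]; first by rewrite big_geq// subrr.
  rewrite big_nat_recr//= IH.
  have -> : margin R N = 2 * margin R N.+1.
    by rewrite /margin addSn exprS; field; rewrite lt0r_neq0// exprn_gt0.
  by lra.
have := margin_gt0 R N; rewrite {2}/margin add0n.
have -> : (2 ^+ 8 : R) = 256 by rewrite -natrX.
by lra.
Qed.

Lemma not_bad y : ~ bad y -> forall n, generic_at n (flow_back n y).
Proof.
move=> nb n.
have one (z : circle R) m : ~ transition q m z -> `|parity_circle q m z| = 1.
  move=> nz; apply/eqP; rewrite eq_le parity_circle_le1/= leNgt.
  by apply/negP.
have nbn : ~ bad_at n y by move=> b; apply: nb; exists n.
by split; apply: one => h; apply: nbn; rewrite /bad_at /=; [left; left|left; right|right].
Qed.

Lemma no_selection : False.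
Proof.
pose A : set (torus R d) := [set y | 0 < parity_circle q 0 (tnth y i1)].
pose sg := @half_turn R d i1.
have msg (B : set (torus R d)) : measurable B -> measurable (sg @^-1` B).
  by apply: mfun_preim; exact: measurable_torus_shift.
have musg B : measurable B -> mu (sg @^-1` B) = mu B by exact: torus_measure_shift.
have mA : measurable A.
  have mp : measurable_fun setT (fun y : torus R d => parity_circle q 0 (tnth y i1)).
    exact: measurableT_comp (@measurable_parity_circle R q q_odd 0) (measurable_tnth _).
  rewrite (_ : A = setT `&` (fun y => parity_circle q 0 (tnth y i1)) @^-1` `]0, +oo[%classic).
    exact: mp.
  by rewrite setTI; apply/seteqP; split => y /=; rewrite in_itv/= andbT.
have flip y : parity_circle q 0 (tnth (sg y) i1) = - parity_circle q 0 (tnth y i1).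
  rewrite /sg half_turnE eqxx (_ : 2^-1 = cell R q 0) ?parity_circle_shift ?normr1//.
  by rewrite /cell expr0 mulr1.
have Ahalf : (mu A <= (2^-1 : R)%:E)%E.
  have : (mu (A `|` sg @^-1` A) <= 1)%E by apply: probability_le1; apply: measurableU => //; exact: msg.
  rewrite measureU//; [|exact: msg|]; last first.
    apply/seteqP; split => // y [] /=; rewrite /A /= flip => h1 h2; lra.
  rewrite [X in (_ + X <= _)%E](_ : _ = mu A); last exact: musg.
  move=> h; have {}h : (mu A + mu A <= 1)%E by exact: h.
  have zE : mu A = (fine (mu A))%:E by rewrite fineK// fin_num_measure.
  by move: h; rewrite zE -EFinD !lee_fin; move: (fine _) => z; lra.
pose E := X T @^-1` A.
have muE : ((mu^*)%mu E = mu A) := selection_pushforward sel TT mA.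
have [B [mB EB Bmu]] : exists B, [/\ measurable B, E `<=` B & (mu B <= (mu^*)%mu E + (8^-1 : R)%:E)%E].
  apply: mu_ext_borel_cover; rewrite ?invr_gt0//.
  by rewrite [ltLHS]muE; apply: le_lt_trans Ahalf _; rewrite ltry.
have mD : measurable (fold_map @^-1` B).
  exact: mfun_preim (measurable_fold_map _ _ q_odd P_ge0 rho_ge0 rho_lt1 profile_le) mB.
have DB : (mu (fold_map @^-1` B) <= mu B)%E.
  apply: (transport TT zeroT) => // x gx; rewrite /= fold_map_selection//.
  by rewrite (characteristic0 T_gt0 C_ge0 v_le gx).
pose L := A `\` fold_map @^-1` B.
have mL : measurable L by exact: measurableD.
(* For a good x, the point X_T x never lies in L: if X_T x is in A, then x is in E, hence in B, and
   x is the image of X_T x under [fold_map]. *)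
have L0 : mu L = 0.
  apply/eqP; rewrite -measure_le0.
  rewrite -[leRHS](measure0 mu); apply: (transport TT TT) => // x gx [Ax].
  by rewrite /= fold_map_selection//; apply; exact: EB.
have mbad : measurable bad by apply: bigcupT_measurable; exact: measurable_bad_at.
(* A point outside both A and [bad] has its half turn in A, with the same image under [fold_map]. If
   this image misses B, the half turn lies in L. *)
have cover : setT `<=` ((fold_map @^-1` B `|` L) `|` sg @^-1` L) `|` bad.
  move=> y _; have [|nb] := pselect (bad y); first by right.
  have gen := not_bad nb.
  left; have [yB|yB] := pselect (fold_map y \in B).
    by left; left; move: yB; rewrite inE.
  have ny : ~ B (fold_map y) by move=> h; apply: yB; rewrite inE.
  have [Ay|nAy] := pselect (A y); first by left; right.
  right; split; last by rewrite /= /sg (fold_half_turn i01 q_odd q_gt1 P_ge0 rho_ge0 rho_lt1 profile_le gen).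
  rewrite /A /= flip; have [y0 _ _] := gen 0%N.
  have : parity_circle q 0 (tnth y i1) <> 0 by move=> h; move: y0; rewrite h normr0; lra.
  move=> h; rewrite oppr_gt0 lt_neqAle; apply/andP; split; first exact/eqP.
  by rewrite leNgt; apply/negP.
have mDL : measurable (fold_map @^-1` B `|` L) by exact: measurableU.
have msL : measurable (sg @^-1` L) by exact: msg.
have mDLs : measurable (fold_map @^-1` B `|` L `|` sg @^-1` L) by exact: measurableU.
have b1 : (mu (fold_map @^-1` B `|` L) <= mu (fold_map @^-1` B) + mu L)%E.
  exact: measureU2.
have b2 : (mu (fold_map @^-1` B `|` L `|` sg @^-1` L) <=
    mu (fold_map @^-1` B `|` L) + mu (sg @^-1` L))%E by exact: measureU2.
have b3 : (mu (fold_map @^-1` B `|` L `|` sg @^-1` L `|` bad) <=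
    mu (fold_map @^-1` B `|` L `|` sg @^-1` L) + mu bad)%E by exact: measureU2.
have b4 : (mu setT <= mu (fold_map @^-1` B `|` L `|` sg @^-1` L `|` bad))%E.
  by apply: le_measure cover; rewrite inE//; exact: measurableU.
have : (mu setT <= (mu (fold_map @^-1` B) + mu L + mu (sg @^-1` L)) + mu bad)%E.
  apply: le_trans b4 _; apply: le_trans b3 _; apply: leeD => //.
  by apply: le_trans b2 _; apply: leeD.
have T1 : mu setT = 1%E by exact: probability_setT.
rewrite T1 musg// L0 !adde0 => h.
(* The three terms are the measure of A, the excess of B over E, and the measure of [bad]. *)
have : (1 <= (2^-1 + 8^-1 + 8^-1 : R)%:E)%E.
  apply: le_trans h _; rewrite !EFinD; apply: leeD => //; last exact: bad_measure.
  apply: le_trans DB _; apply: le_trans Bmu _; apply: leeD => //.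
  by rewrite [leLHS]muE.
by rewrite lee_fin; lra.
Qed.

End no_selection.

(** * Incompressibility *)

Section torus_functions.
Variables (R : realType) (d : nat).
Local Notation mu := (torus_measure R d).

Definition torus_rep (x : torus R d) : 'rV[R]_d := \row_i circle_rep (tnth x i).

Lemma torus_repK x : torus_proj (torus_rep x) = x.
Proof. by apply: eq_from_tnth => i; rewrite tnth_mktuple mxE circle_repK. Qed.

Lemma torus_rep_bounds x i : 0 <= torus_rep x ord0 i <= 1.
Proof.
rewrite mxE /circle_rep /circle_fun; set r := repr _.
by have /andP[] := floor_itv r; rewrite intrD => h1 h2; apply/andP; split; lra.
Qed.

Lemma torus_proj_shift (p v : 'rV[R]_d) :
  torus_proj (v + p) = torus_shift (torus_proj p) v.
Proof.
apply: eq_from_tnth => i; rewrite !tnth_mktuple mxE addrC.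
exact: circle_piD.
Qed.

(** The torus carries the product sigma-algebra, so [psi] is approached through grids: rounding
    coordinates down to multiples of 1/(n+1) gives measurable functions with countably many values,
    which converge pointwise by continuity. *)
Lemma measurable_torus_continuous (psi : 'rV[R]_d -> R) : continuous psi ->
  measurable_fun setT (fun x : torus R d => psi (torus_rep x)).
Proof.
move=> cpsi.
pose g (n : nat) (x : torus R d) : {ffun 'I_d -> int} :=
  [ffun i => Num.floor (torus_rep x ord0 i * n.+1%:R)].
pose h (n : nat) (z : {ffun 'I_d -> int}) : R := psi (\row_i ((z i)%:~R / n.+1%:R)).
apply: (@measurable_fun_cvg _ _ _ _ (fun n x => h n (g n x))) => [n|x _].
  move=> _ B mB; rewrite setTI.
  have -> : (fun x => h n (g n x)) @^-1` B =
    \bigcup_z (if h n z \in B then \bigcap_i [set x | g n x i = z i] else set0).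
    apply/seteqP; split => [x /= Bx|x [z _]].
      by exists (g n x) => //; rewrite mem_set.
    case: ifPn => //; rewrite inE => Bz xz; rewrite /= (_ : g n x = z)//.
    by apply/ffunP => i; exact: xz.
  apply: countable_bigcupT_measurable => // z; case: ifPn => // _.
  apply: fin_bigcap_measurable => [|i _]; first exact: finite_finset.
  pose m (x : torus R d) : R := (Num.floor (torus_rep x ord0 i * n.+1%:R))%:~R.
  have mm : measurable_fun setT m.
    have mrep : measurable_fun setT (fun x : torus R d => torus_rep x ord0 i).
      rewrite (_ : (fun x : torus R d => _) = (@circle_rep R) \o (@tnth d (circle R))^~ i).
        exact: measurableT_comp (@measurable_circle_rep R) (measurable_tnth _).
      by apply/funext => x /=; rewrite mxE.
    have mfl : measurable_fun (setT : set (measurableTypeR R))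
        (fun r : R => (Num.floor (r * n.+1%:R))%:~R : R).
      apply: nondecreasing_measurable => // r s rs.
      by rewrite ler_int le_floor// ler_wpM2r.
    exact: measurableT_comp mfl mrep.
  rewrite (_ : mkset _ = setT `&` m @^-1` [set (z i)%:~R]); first exact: mm.
  rewrite setTI; apply/seteqP; split => x /=; rewrite /m ffunE; first by move=> ->.
  by move=> /intr_inj.
have cv : (\row_i ((g n x i)%:~R / n.+1%:R) : 'rV[R]_d) @[n --> \oo] --> torus_rep x.
  apply/cvgrPdist_le => e e0.
  have := @cvg_harmonic R; move=> /cvgrPdist_le /(_ e e0); apply: filterS => n.
  rewrite sub0r normrN /harmonic/= ger0_norm ?invr_ge0// => ne.
  apply: le_trans ne; apply: rV_norm_le; first by rewrite invr_ge0.
  move=> i; rewrite mxE [X in _ + X]mxE [X in _ - X]mxE ffunE.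
  set r := torus_rep x ord0 i.
  have n0 : 0 < n.+1%:R :> R by [].
  rewrite -[r](@mulfK _ n.+1%:R) ?lt0r_neq0// {2}mulfK ?lt0r_neq0//.
  rewrite -mulrBl normrM [X in _ * X]ger0_norm ?invr_ge0// ler_piMl ?invr_ge0//.
  have /andP[] := floor_itv (r * n.+1%:R); rewrite intrD => h1 h2.
  by rewrite ger0_norm; lra.
exact: (cvg_comp _ _ cv (cpsi (torus_rep x))).
Qed.

Lemma torus_integral_shift (v : 'rV[R]_d) (g : torus R d -> R) (M : R) :
  measurable_fun setT g -> (forall x, `|g x| <= M) ->
  (\int[mu]_x (g (torus_shift x v))%:E = \int[mu]_x (g x)%:E)%E.
Proof.
move=> mg gM.
pose s x := torus_shift x v.
have ms : measurable_fun setT s by exact: measurable_torus_shift.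
pose sm : {mfun _ >-> _} := HB.pack s (isMeasurableFun.Build _ _ _ _ _ ms).
have intg : mu.-integrable (s @^-1` setT) ((EFin \o g) \o s).
  rewrite preimage_setT; apply: (@measurable_bounded_integrable _ _ _ mu (g \o s)) => //.
  - have T1 : mu setT = 1%E by exact: probability_setT.
    by rewrite [ltLHS]T1 ltry.
  - exact: measurableT_comp.
  - by exists M; split; rewrite ?num_real// => r Mr x _ /=; rewrite (le_trans (gM _))// ltW.
have mEg : measurable_fun setT (EFin \o g) by exact/measurable_EFinP.
have := @integral_pushforward _ _ _ _ _ _ ms mu setT _ mEg intg measurableT.
rewrite preimage_setT => <-.
apply: (@eq_measure_integral _ _ _ _ mu (pushforward mu sm)) => A mA _.
exact: torus_measure_shift.
Qed.

Lemma is_derive_line (psi : 'rV[R]_d -> R) (p e : 'rV[R]_d) (s : R) :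
  derivable psi (s *: e + p) e ->
  is_derive s 1 (fun t : R => psi (t *: e + p)) ('D_e psi (s *: e + p)).
Proof.
move=> dp.
have E : (fun h : R => h^-1 *: (((fun t : R => psi (t *: e + p)) \o shift s) (h *: 1) -
      psi (s *: e + p))) =
    (fun h => h^-1 *: ((psi \o shift (s *: e + p)) (h *: e) - psi (s *: e + p))).
  by apply/funext => h /=; rewrite scalerDl [h *: (1 : R)]mulr1 addrA.
by split; rewrite /derivable /derive E.
Qed.

(** Supplies the constant for dominated convergence. By the mean value theorem each quotient is a
    value of the derivative in the box of half-width |e| + 1, which contains all the segments
    concerned. *)
Lemma slope_bounded (psi : 'rV[R]_d -> R) (e : 'rV[R]_d) :
  (forall x, derivable psi x e) -> continuous ('D_e psi) ->
  exists2 M, 0 <= M & forall (p : 'rV[R]_d) h, (forall i, 0 <= p ord0 i <= 1) ->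
    0 < h <= 1 -> `|h^-1 * (psi (h *: e + p) - psi p)| <= M.
Proof.
move=> dpsi cpsi.
pose N := `|e| + 1.
pose K : set 'rV[R]_d := [set v | forall i, v ord0 i \in `[- N, N]].
have cK : compact K.
  have := @rV_compact R d (fun=> `[- N, N]%classic) (fun=> @segment_compact R (- N) N).
  by congr compact.
have /compact_bounded[M [_ hM]] : compact ('D_e psi @` K).
  by apply: continuous_compact => //; exact: continuous_subspaceT.
exists (`|M| + 1); first by rewrite addr_ge0.
move=> p h p01 /andP[h0 h1].
have dl (s : R) : is_derive s 1 (fun t : R => psi (t *: e + p)) ('D_e psi (s *: e + p)).
  exact: is_derive_line.
have [|c c0h] := @MVT R _ _ 0 h h0 (fun s _ => dl s).
  apply: continuous_subspaceT => s; apply: differentiable_continuous.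
  by apply/derivable1_diffP; have [] := dl s.
rewrite scale0r add0r subr0 => ->.
rewrite mulrC mulfK ?lt0r_neq0//.
apply: (hM (`|M| + 1)); first by rewrite ltr_pwDr// ler_norm.
exists (c *: e + p) => // i.
move: c0h; rewrite !in_itv/= => /andP[c0 ch].
rewrite -ler_norml !mxE; apply: le_trans (ler_normD _ _) _.
rewrite normrM /N; apply: lerD; last first.
  by have /andP[? ?] := p01 i; rewrite ger0_norm.
rewrite -[leRHS]mul1r ler_pM ?rV_norm_ge//.
by rewrite ger0_norm ?ltW// (lt_le_trans ch).
Qed.

(* Integrals of difference quotients of the test function along e_i vanish by
   translation invariance; the claim is their limit. *)
Lemma div_free_of_invariant (w : torus R d -> 'rV[R]_d) (B : R) :
  (forall i, measurable_fun setT (fun x => w x ord0 i)) ->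
  (forall x i, `|w x ord0 i| <= B) ->
  (forall x i h, w (torus_shift x (h *: basis_vec R i)) ord0 i = w x ord0 i) ->
  div_free w.
Proof.
move=> mw wB winv phi sphi.
pose psi := phi \o @torus_proj R d.
have [cpsi _] := sphi [::].
have mphi : measurable_fun setT phi.
  rewrite (_ : phi = fun x => psi (torus_rep x)); first exact: measurable_torus_continuous.
  by apply/funext => x; rewrite /psi /= torus_repK.
have [Mphi phiM] : exists M, forall x, `|phi x| <= M.
  have cK : compact [set v : 'rV[R]_d | forall i, v ord0 i \in `[0, 1]].
    have := @rV_compact R d (fun=> `[0, 1]%classic) (fun=> @segment_compact R 0 1).
    by congr compact.
  have /compact_bounded[M [_ hM]] : compact (psi @` [set v : 'rV[R]_d | forall i, v ord0 i \in `[0, 1]]).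
    by apply: continuous_compact => //; exact: continuous_subspaceT.
  exists (`|M| + 1) => x; apply: (hM (`|M| + 1)); first by rewrite ltr_pwDr// ler_norm.
  exists (torus_rep x); last by rewrite /psi /= torus_repK.
  by move=> i; rewrite in_itv/=; exact: torus_rep_bounds.
have one i : mu.-integrable setT (fun x => (w x ord0 i * torus_partial i phi x)%:E) /\
    (\int[mu]_x (w x ord0 i * torus_partial i phi x)%:E = 0)%E.
  have [_ /(_ i) dpsi] := sphi [::].
  have [cD _] := sphi [:: i].
  have [M M0 hM] := slope_bounded dpsi cD.
  pose h (n : nat) : R := n.+1%:R^-1.
  have h0 n : 0 < h n by rewrite invr_gt0.
  pose e := basis_vec R i.
  pose f n x := w x ord0 i * ((h n)^-1 * (phi (torus_shift x (h n *: e)) - phi x)).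
  have mshift n : measurable_fun setT (fun x => phi (torus_shift x (h n *: e))).
    exact: measurableT_comp mphi (measurable_torus_shift _).
  have mf n : measurable_fun setT (f n).
    by apply: measurable_funM => //; apply: measurable_funM => //; exact: measurable_funB.
  have fB n x : `|f n x| <= B * M.
    (* The lift [torus_rep] has entries in [0, 1], as the uniform bound requires. *)
    rewrite normrM ler_pM// -{2}[x]torus_repK -{1}[x]torus_repK -torus_proj_shift.
    apply: hM; first exact: torus_rep_bounds.
    by rewrite h0/= /h invf_le1// ler1n.
  have ff x : f ^~ x @ \oo --> w x ord0 i * torus_partial i phi x.
    apply: cvgM; first exact: cvg_cst.
    have hn : h @ \oo --> 0^'.
      move=> A A0.
      have H : \forall n \near \oo, h n != 0 -> A (h n) := @cvg_harmonic R _ A0.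
      by apply: (filterS _ H) => n; apply; exact: lt0r_neq0 (h0 n).
    (* Here the other lift appears, the one at which [torus_partial] is evaluated. *)
    have := cvg_comp _ _ hn (dpsi (torus_lift x)).
    apply: cvg_trans; apply: near_eq_cvg; apply: nearW => n /=.
    by rewrite torus_proj_shift torus_liftK.
  have f0 n : (\int[mu]_x (f n x)%:E = 0)%E.
    pose g x := w x ord0 i * phi x.
    have mg : measurable_fun setT g by exact: measurable_funM.
    have gB x : `|g x| <= B * Mphi by rewrite normrM ler_pM.
    have intg (s : torus R d -> R) : measurable_fun setT s ->
        (forall x, `|s x| <= B * Mphi) -> mu.-integrable setT (EFin \o s).
      move=> ms sB; apply: measurable_bounded_integrable => //.
        have T1 : mu setT = 1%E by exact: probability_setT.
        by rewrite [ltLHS]T1 ltry.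
      by exists (B * Mphi); split; rewrite ?num_real// => r Mr x _ /=; rewrite (le_trans (sB _))// ltW.
    pose g' x := g (torus_shift x (h n *: e)).
    have mg' : measurable_fun setT g' by exact: measurableT_comp mg (measurable_torus_shift _).
    have i1 := intg _ mg gB.
    have i2 : mu.-integrable setT (EFin \o g') by apply: intg => // x; exact: gB.
    (* Invariance of the i-th component along e_i lets the shift act on the whole product g, whose
       integral it preserves. *)
    have E x : (f n x)%:E = ((h n)^-1%:E * ((g' x)%:E - (g x)%:E))%E.
      rewrite -EFinB -EFinM; congr EFin.
      by rewrite /f /g' /g winv mulrCA mulrBr.
    under eq_integral do rewrite E.
    rewrite integralZl//; last exact: integrableB.
    rewrite integralB//= (torus_integral_shift _ mg gB) subee ?mule0//.
    exact: integrable_fin_num.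
  have mlim : measurable_fun setT (fun x => w x ord0 i * torus_partial i phi x).
    by apply: (@measurable_fun_cvg _ _ _ _ f) => // x _; exact: ff.
  have [] := @dominated_convergence _ _ _ mu setT measurableT (fun n x => (f n x)%:E)
    (fun x => (w x ord0 i * torus_partial i phi x)%:E) (cst (B * M)%:E).
  - by move=> n; exact/measurable_EFinP.
  - exact/measurable_EFinP.
  - by apply: aeW => x _; apply: cvg_EFin; [exact: nearW|exact: ff].
  - exact: finite_measure_integrable_cst.
  - by apply: aeW => x n _; rewrite /= lee_fin.
  move=> I1 _ I2; split => //.
  have : (fun n => \int[mu]_x (f n x)%:E)%E @ \oo --> 0%E.
    by under eq_fun do rewrite f0; exact: cvg_cst.
  by apply: cvg_unique.
rewrite /Rintegral.
under eq_integral do rewrite -sumEFin.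
rewrite integral_sum//; last by move=> i; exact: (one i).1.
by rewrite big1// => i _; exact: (one i).2.
Qed.

End torus_functions.

Lemma odd_powR_ge (R : realType) (b c : R) : 0 < b -> 1 <= c ->
  exists q : nat, [/\ odd q, (1 < q)%N & c <= q%:R `^ b].
Proof.
move=> b0 c1; have c0 : 0 < c by apply: lt_le_trans c1.
(* m exceeds c^(1/b); 2 m + 1 is moreover odd and larger than 1. *)
pose m := (Num.truncn (c `^ b^-1)).+1; exists (m.*2.+1).
split; [by rewrite /= odd_double|by rewrite ltnS double_gt0|].
have cE : c = (c `^ b^-1) `^ b by rewrite -powRrM mulVf ?lt0r_neq0// powRr1// ltW.
rewrite [leLHS]cE; apply: ge0_ler_powR; rewrite ?nnegrE ?powR_ge0 ?(ltW b0)//.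
apply: ltW; apply: lt_le_trans (truncnS_gt _) _; rewrite ler_nat.
by rewrite -addnn ltnW// ltnS leq_addr.
Qed.

(** Each term moves one coordinate by a function of a different one, so every component of the field
    is invariant along its own direction. *)
Lemma time_series_div_free (R : realType) (d : nat) (a T : R) (k q : nat) (i0 i1 : 'I_d)
    (v : nat -> holder_map d a) (t : R) : odd q -> i0 != i1 ->
  (forall n x l, v n x ord0 l =
    (l == moving i0 i1 n)%:R * - profile_circle q n (tnth x (resting i0 i1 n))) ->
  div_free (time_series T k v 0 t).
Proof.
move=> q_odd i01 vE.
have uE x l : time_series T k v 0 t x ord0 l = \sum_(n < slot_count T t) time_coef T k 0 n t *
    ((l == moving i0 i1 n)%:R * - profile_circle q n (tnth x (resting i0 i1 n))).
  by rewrite holder_map_sumE; apply: eq_bigr => n _; rewrite vE.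
apply: (@div_free_of_invariant _ _ _ `|time_series T k v 0 t|).
- move=> l; under eq_fun do rewrite uE.
  apply: measurable_sum => n; apply: measurable_funM => //; apply: measurable_funM => //.
  apply: measurableT_comp => //.
  exact: measurableT_comp (@measurable_profile_circle R q q_odd n) (measurable_tnth _).
- by move=> x l; exact: holder_entry_le.
- move=> x l h; rewrite !uE; apply: eq_bigr => n _; congr (_ * _).
  have [->|] := eqVneq l (moving i0 i1 n); last by rewrite !mul0r.
  rewrite tnth_mktuple !mxE eqxx (negbTE (resting_neq i01 n)).
  by rewrite mulr0 circle_pi0 addr0.
Qed.

Theorem theorem1p2 (R : realType) (d : nat) (T : R) :
  (2 <= d)%N -> 0 < T ->
  forall (k : nat) (alpha : R), 0 < alpha < 1 ->
  exists u : R -> holder_map d alpha,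
    [/\ Ck_on 0 T k u,
        forall t, t \in `[0, T] -> div_free (u t)
      & ~ exists X : R -> torus R d -> torus R d,
          measure_preserving_selection T u X].
Proof.
move=> d2 T0 k alpha a01; have /andP[a0 a1] := a01.
have [q [q_odd q1 hq]] : exists q : nat, [/\ odd q, (1 < q)%N & 2 ^+ (k + 5) <= q%:R `^ (1 - alpha)].
  by apply: odd_powR_ge; rewrite ?subr_gt0// exprn_ege1// ler1n.
pose i0 := Ordinal (ltnW d2 : (0 < d)%N); pose i1 := Ordinal d2.
have i01 : i0 != i1 by [].
have [C C0 hC] := @profile_decay R q q_odd alpha k a01 hq.
pose rho : R := (2 ^+ (k + 4))^-1.
(* The sign is reversed because [profile] is designed for the backward step. *)
pose w n x : R := - profile q n x.
have w1 n x (z : int) : w n (x + z%:~R) = w n x by rewrite /w profileDint.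
have w2 n x : `|w n x| <= C * rho ^+ n by rewrite /w normrN; have [] := hC n x x.
have w3 n x y : `|w n x - w n y| <= C * rho ^+ n * `|x - y| `^ alpha.
  by rewrite /w -opprD normrN; have [] := hC n x y.
pose v n := shear_map (moving i0 i1 n) (resting i0 i1 n) (w1 n) (w2 n) (w3 n) (ltW a0).
have vE n x l : v n x ord0 l =
    (l == moving i0 i1 n)%:R * - profile_circle q n (tnth x (resting i0 i1 n)).
  exact: shear_fieldE.
have v_le n : `|v n| <= (C + C) * rho ^+ n.
  by rewrite mulrDl; exact: shear_map_norm.
have CC0 : 0 <= C + C by rewrite addr_ge0// ltW.
have rho0 : 0 <= rho by rewrite invr_ge0 exprn_ge0.
have rho1 : rho < 1.
  by rewrite invf_lt1 ?exprn_gt0// exprn_egt1// ?ltr1n// addn_eq0 andbF.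
exists (time_series T k v 0); split.
- exact: (Ck_time_series T0 CC0 v_le).
- by move=> t _; exact: time_series_div_free q_odd i01 vE.
- move=> [X sel].
  apply: (no_selection T0 CC0 i01 v_le vE q_odd q1 (ltW C0) rho0 rho1 _ sel).
  by move=> n x; have [] := hC n x x.
Qed.
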